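(* Let $M$ be a smooth manifold, $p\ge1$, and let $L$ be an isotropic, involutive subbundle of $E^p=TM\oplus\wedge^pT^*M$. Then the complex $$C^\infty(M)\xrightarrow{d}\cdots\xrightarrow{d}\Omega^{p-2}(M)\xrightarrow{d}\Omega^{p-1}_{ham}(M,L),$$ concentrated in degrees $-p+1,\dots,0$, has a Lie $p$-algebra structure. The only non-vanishing multibrackets are given by the de Rham differential on $\Omega^{\le p-2}(M)$ (the unary bracket) and, for $k=2,\dots,p+1$, by $$l_k(\alpha_1,\dots,\alpha_k)=\epsilon(k)\,\iota_{X_{\alpha_k}}\cdots\iota_{X_{\alpha_3}}\{\alpha_1,\alpha_2\},$$ where $\alpha_1,\dots,\alpha_k\in\Omega^{p-1}_{ham}(M,L)$, and $\epsilon(k)=(-1)^{\frac k2+1}$ if $k$ is even, $\epsilon(k)=(-1)^{\frac{k-1}{2}}$ if $k$ is odd.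
   Context: On $E^p=TM\oplus\wedge^pT^*M$ let $\langle X+\alpha,Y+\beta\rangle=\iota_X\beta+\iota_Y\alpha$ and let $[\![X+\alpha,Y+\beta]\!]=[X,Y]+\mathcal{L}_X\beta-\iota_Yd\alpha$ be the Dorfman bracket on sections. A subbundle $L$ is isotropic if $\langle\cdot,\cdot\rangle$ vanishes on $L\times L$, and involutive if $\Gamma(L)$ is closed under the Dorfman bracket. A form $\alpha\in\Omega^{p-1}(M)$ is Hamiltonian if there is a smooth vector field $X_\alpha$, called a Hamiltonian vector field of $\alpha$ (not unique in general), with $X_\alpha+d\alpha\in\Gamma(L)$. $\Omega^{p-1}_{ham}(M,L)$ is the space of Hamiltonian forms, and $\{\alpha,\beta\}:=\iota_{X_\alpha}d\beta$ for any choice of Hamiltonian vector field $X_\alpha$. In the multibrackets, $X_{\alpha_i}$ is any Hamiltonian vector field of $\alpha_i$ (the result does not depend on the choice). For $k\ge 2$, $l_k$ vanishes when one of its entries has negative degree. An $L_\infty$-algebra is a graded vector space $V=\bigoplus_{i\in\mathbb Z}V_i$ with multilinear maps $l_n$ ($n\ge1$) in $n$ arguments, of degree $2-n$, which are graded skew-symmetric, $l_n(\dots,v_k,v_{k+1},\dots)=-(-1)^{|v_k||v_{k+1}|}l_n(\dots,v_{k+1},v_k,\dots)$, and satisfy for each $n\ge1$ $$\sum_{i+j=n+1}\ \sum_{\sigma\in Sh(i,n-i)}\chi(\sigma)(-1)^{i(j-1)}l_j\big(l_i(v_{\sigma(1)},\dots,v_{\sigma(i)}),v_{\sigma(i+1)},\dots,v_{\sigma(n)}\big)=0,$$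 where $Sh(i,n-i)$ is the set of permutations preserving the order of the first $i$ and of the last $n-i$ elements, and $\chi(\sigma)$ is the sign of $\sigma$ times the Koszul sign of the permutation of $v_1,\dots,v_n$. A Lie $p$-algebra is an $L_\infty$-algebra concentrated in degrees $-p+1,\dots,0$. *)

(* Defs.v *)
From HB Require Import structures.
From mathcomp Require Import all_boot all_order all_algebra perm.
From mathcomp Require Import all_classical all_reals all_analysis.
From mathcomp Require Import ring.

Set Implicit Arguments.
Unset Strict Implicit.
Unset Printing Implicit Defensive.

Import Order.TTheory GRing.Theory Num.Theory.
Import numFieldNormedType.Exports.

Local Open Scope classical_set_scope.
Local Open Scope ring_scope.

Section SmoothRn.
Context {R : realType} {n : nat}.
Implicit Types (U : set 'rV[R]_n) (f g : 'rV[R]_n -> R).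

Definition is_partial (i : 'I_n) f (x : 'rV[R]_n) (l : R) : Prop :=
  is_derive (0 : R) (1 : R) (fun t : R => f (x + t *: delta_mx 0 i)) l.

Fixpoint Ck (k : nat) U f : Prop :=
  (forall x, U x -> {for x, continuous f}) /\
  if k is k'.+1 then
    forall i, exists2 g, (forall x, U x -> is_partial i f x (g x)) & Ck k' U g
  else True.

Definition Cinfty U f := forall k, Ck k U f.

Lemma Ck_continuous k U f :
  Ck k U f -> forall x, U x -> {for x, continuous f}.
Proof. by case: k => [|k] []. Qed.

Lemma CkW k U f : Ck k.+1 U f -> Ck k U f.
Proof.
elim: k f => [|k IH] f [cf df]; split=> // i.
by have [g fg /IH gk] := df i; exists g.
Qed.

Lemma Ck_cst k U c : Ck k U (cst c).
Proof.
elim: k c => [|k IH] c; split=> //; try by move=> x _; exact: cst_continuous.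
by move=> i; exists (cst 0) => // x _; exact: is_derive_cst.
Qed.

Lemma CkD k U f g : Ck k U f -> Ck k U g -> Ck k U (f + g).
Proof.
elim: k f g => [|k IH] f g [cf df] [cg dg]; split=> //;
  try by move=> x Ux; apply: continuousD; [exact: cf | exact: cg].
move=> i; have [f' ff' kf] := df i; have [g' gg' kg] := dg i.
exists (f' + g'); last exact: IH.
by move=> x Ux; apply: is_deriveD; [exact: ff' | exact: gg'].
Qed.

Lemma CkM k U f g : Ck k U f -> Ck k U g -> Ck k U (f * g).
Proof.
elim: k f g => [|k IH] f g kf kg; have cf := Ck_continuous kf;
  have cg := Ck_continuous kg; split=> //;
  try by move=> x Ux; apply: continuousM; [exact: cf | exact: cg].
move=> i; have [f' ff' kf'] := kf.2 i; have [g' gg' kg'] := kg.2 i.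
exists (f * g' + g * f'); last first.
  by apply: CkD; apply: IH => //; exact: CkW.
move=> x Ux; have := is_deriveM (ff' x Ux) (gg' x Ux).
by rewrite scale0r addr0.
Qed.

End SmoothRn.

Record chart (R : realType) (n : nat) (T : topologicalType) := Chart {
  cdom : set T;
  cmap : T -> 'rV[R]_n;
  cinv : 'rV[R]_n -> T;
  cdom_open : open cdom;
  cimg_open : open (cmap @` cdom);
  cmapK : {in cdom, cancel cmap cinv};
  cmap_continuous : {within cdom, continuous cmap};
  cinv_continuous : {within cmap @` cdom, continuous cinv} }.

Definition charts_compatible (R : realType) (n : nat) (T : topologicalType)
    (c c' : chart R n T) : Prop :=
  forall j : 'I_n, Cinfty (cmap c @` (cdom c `&` cdom c'))
    (fun x => cmap c' (cinv c x) 0 j).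

Record manifold (R : realType) (n : nat) := Manifold {
  carrier :> topologicalType;
  atlas : set (chart R n carrier);
  manifold_hausdorff : hausdorff_space carrier;
  manifold_second_countable : @second_countable carrier;
  atlas_cover : forall x : carrier, exists2 c, atlas c & cdom c x;
  atlas_compatible : forall c c', atlas c -> atlas c' ->
    charts_compatible c c' }.

Section SmoothFunctions.
Context {R : realType} {n : nat} (M : manifold R n).

Definition is_smooth (f : M -> R) : Prop :=
  forall c, atlas c -> Cinfty (cmap c @` cdom c) (f \o cinv c).

Definition smooth : {pred M -> R} := fun f => `[< is_smooth f >].

Record smoothfun := SmoothFun { sf_val :> M -> R; _ : sf_val \in smooth }.

HB.instance Definition _ := [isSub for sf_val].
HB.instance Definition _ := [Choice of smoothfun by <:].

Lemma smooth_cst (c : R) : (cst c : M -> R) \in smooth.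
Proof. by apply/asboolP => e _ k; exact: Ck_cst. Qed.

Lemma smooth_subring : subring_closed smooth.
Proof.
have mulS f g : f \in smooth -> g \in smooth -> f * g \in smooth.
  move=> /asboolP sf /asboolP sg; apply/asboolP => e Ae k.
  by apply: (@CkM _ _ k _ (f \o cinv e) (g \o cinv e)); [exact: sf | exact: sg].
split => [|f g sf sg|]; last exact: mulS; first exact: smooth_cst.
have /asboolP sNg := mulS _ _ (smooth_cst (-1)) sg.
move/asboolP: sf => sf; apply/asboolP => e Ae k.
have -> : (f - g) \o cinv e = (f \o cinv e) + ((cst (-1) * g) \o cinv e).
  by apply/funext => x; rewrite !fctE mulN1r.
by apply: CkD; [exact: sf | exact: sNg].
Qed.

HB.instance Definition _ := GRing.isSubringClosed.Build (M -> R) smooth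
  smooth_subring.
HB.instance Definition _ := GRing.SubChoice_isSubComPzRing.Build (M -> R) smooth
  smoothfun smooth_subring.

Definition sf_cst (c : R) : smoothfun := SmoothFun (smooth_cst c).

Definition sf_scale (c : R) (f : smoothfun) : smoothfun := sf_cst c * f.

Lemma sf_scaleA a b f : sf_scale a (sf_scale b f) = sf_scale (a * b) f.
Proof. by rewrite /sf_scale mulrA; congr (_ * _); apply: val_inj. Qed.

Lemma sf_scale1 : left_id 1 sf_scale.
Proof. by move=> f; rewrite -[RHS]mul1r; congr (_ * _); apply: val_inj. Qed.

Lemma sf_scaleDr : right_distributive sf_scale +%R.
Proof. by move=> c f g; rewrite /sf_scale mulrDr. Qed.

Lemma sf_scaleDl f : {morph sf_scale^~ f : a b / a + b}.
Proof.
by move=> a b; rewrite /sf_scale -mulrDl; congr (_ * _); apply: val_inj.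
Qed.

HB.instance Definition _ := GRing.Zmodule_isLmodule.Build R smoothfun
  sf_scaleA sf_scale1 sf_scaleDr sf_scaleDl.

End SmoothFunctions.

Section Tangent.
Context {R : realType} {n : nat} (M : manifold R n) (x : M).
Local Notation C := (smoothfun M).

Definition derivation_at : {pred C -> R} := fun v =>
  `[< (forall (c : R) (f g : C), v (c *: f + g) = c * v f + v g) /\
      (forall f g : C, v (f * g) = f x * v g + g x * v f) >].

Record tangent := Tangent { tv_val :> C -> R; _ : tv_val \in derivation_at }.

HB.instance Definition _ := [isSub for tv_val].
HB.instance Definition _ := [Choice of tangent by <:].

Lemma derivation_at_zmod : zmod_closed derivation_at.
Proof.
split=> [|u v /asboolP[u1 u2] /asboolP[v1 v2]]; apply/asboolP; split.
- by move=> c f g; apply/esym; rewrite addr0 mulr0.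
- by move=> f g; apply/esym; rewrite !mulr0 addr0.
- by move=> c f g; rewrite !fctE u1 v1 mulrBr opprD addrACA.
- by move=> f g; rewrite !fctE u2 v2 !mulrBr opprD addrACA.
Qed.

HB.instance Definition _ := GRing.isZmodClosed.Build (C -> R) derivation_at
  derivation_at_zmod.
HB.instance Definition _ := [SubChoice_isSubZmodule of tangent by <:].

Lemma tv_linear (v : tangent) (c : R) (f g : C) :
  v (c *: f + g) = c * v f + v g.
Proof. by have /asboolP[+ _] := valP v; exact. Qed.

Lemma tv_leibniz (v : tangent) (f g : C) : v (f * g) = f x * v g + g x * v f.
Proof. by have /asboolP[_ +] := valP v; exact. Qed.

Lemma tv_scale_subproof (c : R) (v : tangent) :
  (fun f : C => c * v f) \in derivation_at.
Proof.
apply/asboolP; split.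
- by move=> a f g; rewrite tv_linear mulrDr mulrCA.
- by move=> f g; rewrite tv_leibniz mulrDr !(mulrCA c).
Qed.

Definition tv_scale c v : tangent := Tangent (tv_scale_subproof c v).

Lemma tv_scaleA a b v : tv_scale a (tv_scale b v) = tv_scale (a * b) v.
Proof. by apply/val_inj/funext => f /=; rewrite mulrA. Qed.

Lemma tv_scale1 : left_id 1 tv_scale.
Proof. by move=> v; apply/val_inj/funext => f /=; rewrite mul1r. Qed.

Lemma tv_scaleDr : right_distributive tv_scale +%R.
Proof. by move=> c u v; apply/val_inj/funext => f; exact: mulrDr. Qed.

Lemma tv_scaleDl v : {morph tv_scale^~ v : a b / a + b}.
Proof. by move=> a b; apply/val_inj/funext => f; exact: mulrDl. Qed.

HB.instance Definition _ := GRing.Zmodule_isLmodule.Build R tangent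
  tv_scaleA tv_scale1 tv_scaleDr tv_scaleDl.

End Tangent.

Section VectorFields.
Context {R : realType} {n : nat} (M : manifold R n).
Local Notation C := (smoothfun M).

Definition derivation : {pred C -> C} := fun X =>
  `[< (forall (c : R) (f g : C), X (c *: f + g) = c *: X f + X g) /\
      (forall f g : C, X (f * g) = f * X g + g * X f) >].

Record vfield := VField { vf_val :> C -> C; _ : vf_val \in derivation }.

HB.instance Definition _ := [isSub for vf_val].
HB.instance Definition _ := [Choice of vfield by <:].

Lemma derivation_zmod : zmod_closed derivation.
Proof.
split=> [|u v /asboolP[u1 u2] /asboolP[v1 v2]]; apply/asboolP; split.
- by move=> c f g; apply/esym; rewrite addr0 scaler0.
- by move=> f g; apply/esym; rewrite !mulr0 addr0.
- by move=> c f g; rewrite !fctE u1 v1 scalerBr opprD addrACA.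
- by move=> f g; rewrite !fctE u2 v2 !mulrBr opprD addrACA.
Qed.

HB.instance Definition _ := GRing.isZmodClosed.Build (C -> C) derivation
  derivation_zmod.
HB.instance Definition _ := [SubChoice_isSubZmodule of vfield by <:].

Lemma vf_linear (X : vfield) (c : R) (f g : C) :
  X (c *: f + g) = c *: X f + X g.
Proof. by have /asboolP[+ _] := valP X; exact. Qed.

Lemma vf_leibniz (X : vfield) (f g : C) : X (f * g) = f * X g + g * X f.
Proof. by have /asboolP[_ +] := valP X; exact. Qed.

Lemma vf_add (X : vfield) (f g : C) : X (f + g) = X f + X g.
Proof. by have := vf_linear X 1 f g; rewrite !scale1r. Qed.

Lemma vf_scale_subproof (h : C) (X : vfield) :
  (fun f : C => h * X f) \in derivation.
Proof.
apply/asboolP; split.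
- move=> a f g; rewrite vf_linear mulrDr; congr (_ + _).
  by rewrite /GRing.scale /= /sf_scale mulrCA.
- by move=> f g; rewrite vf_leibniz mulrDr !(mulrCA h).
Qed.

Definition vf_scale h X : vfield := VField (vf_scale_subproof h X).

Lemma vf_scaleA a b X : vf_scale a (vf_scale b X) = vf_scale (a * b) X.
Proof. by apply/val_inj/funext => f /=; rewrite mulrA. Qed.

Lemma vf_scale1 : left_id 1 vf_scale.
Proof. by move=> X; apply/val_inj/funext => f /=; rewrite mul1r. Qed.

Lemma vf_scaleDr : right_distributive vf_scale +%R.
Proof. by move=> h X Y; apply/val_inj/funext => f; exact: mulrDr. Qed.

Lemma vf_scaleDl X : {morph vf_scale^~ X : a b / a + b}.
Proof. by move=> a b; apply/val_inj/funext => f; exact: mulrDl. Qed.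

HB.instance Definition _ := GRing.Zmodule_isLmodule.Build C vfield
  vf_scaleA vf_scale1 vf_scaleDr vf_scaleDl.

Lemma vf_bracket_subproof (X Y : vfield) :
  (fun f : C => X (Y f) - Y (X f)) \in derivation.
Proof.
apply/asboolP; split=> [c f g|f g].
- by rewrite !vf_linear scalerBr opprD addrACA.
- rewrite (vf_leibniz Y) (vf_leibniz X f g) !vf_add !vf_leibniz; ring.
Qed.

Definition vf_bracket (X Y : vfield) : vfield :=
  VField (vf_bracket_subproof X Y).

Lemma vf_at_subproof (x : M) (X : vfield) :
  (fun f : C => X f x) \in derivation_at x.
Proof.
apply/asboolP; split=> [c f g|f g].
- by rewrite vf_linear.
- by rewrite vf_leibniz.
Qed.

Definition vf_at (x : M) (X : vfield) : tangent x :=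
  Tangent (vf_at_subproof x X).

End VectorFields.

(* A k-linear alternating map is represented by a function on lists that
   vanishes on the lists whose length is not k, so that forms of all degrees
   live in one module. *)
Definition alternating_map (A : comPzRingType) (V : lmodType A) (k : nat)
    (w : seq V -> A) : Prop :=
  [/\ forall s, size s != k -> w s = 0,
      forall s1 s2 a u v, w (s1 ++ (a *: u + v) :: s2) =
        a * w (s1 ++ u :: s2) + w (s1 ++ v :: s2)
    & forall s1 s2 s3 v, w (s1 ++ v :: s2 ++ v :: s3) = 0].

Definition interior_product (V B : Type) (v : V) (w : seq V -> B) :
    seq V -> B :=
  fun s => w (v :: s).

Definition delete_nth (T : Type) (i : nat) (s : seq T) : seq T :=
  take i s ++ drop i.+1 s.

Section Forms.
Context {R : realType} {n : nat} (M : manifold R n).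

Definition cochain : Type := seq (vfield M) -> smoothfun M.

(* Omega^k(M), as the alternating maps X(M)^k -> C^infty(M) that are
   multilinear over C^infty(M) *)
Definition Omega (k : nat) : set cochain :=
  [set w | alternating_map (V := vfield M) k w].

(* Koszul's formula
     dw(X_0,..,X_k) = sum_i (-1)^i X_i(w(X_0,..,^X_i,..,X_k))
       + sum_(i<j) (-1)^(i+j) w([X_i,X_j],X_0,..,^X_i,..,^X_j,..,X_k) *)
Definition dR (w : cochain) : cochain := fun s =>
  \sum_(i < size s) (-1) ^+ i * nth (0 : vfield M) s i (w (delete_nth i s))
  + \sum_(j < size s) \sum_(i < j) (-1) ^+ (i + j) *
      w (vf_bracket (nth 0 s i) (nth 0 s j) :: delete_nth i (delete_nth j s)).

(* (L_X w)(X_1,..,X_k) = X(w(X_1,..,X_k)) - sum_i w(X_1,..,[X,X_i],..,X_k) *)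
Definition lie_derivative (X : vfield M) (w : cochain) : cochain := fun s =>
  X (w s) - \sum_(i < size s)
    w (take i s ++ vf_bracket X (nth 0 s i) :: drop i.+1 s).

End Forms.

Section HigherCourant.
Context {R : realType} {n : nat} (M : manifold R n).

(* TM (+) wedge^p T^*M at x is the set of the (v, a) : bundle_fiber x such that
   a is an alternating p-form on the tangent space at x. *)
Definition bundle_fiber (x : M) : Type :=
  (tangent x * (seq (tangent x) -> R^o))%type.

Definition in_fiber (p : nat) (x : M) (z : bundle_fiber x) : Prop :=
  alternating_map (A := R) (V := tangent x) p z.2.

Definition bundle_section : Type := (vfield M * cochain M)%type.

(* z is the value at x of the section e of E^p *)
Definition value_at (p : nat) (x : M) (e : bundle_section)
    (z : bundle_fiber x) : Prop :=
  [/\ z.1 = vf_at x e.1, in_fiber p z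
    & forall s : seq (vfield M), z.2 (map (vf_at x) s) = e.2 s x].

(* L_x is a subspace of the fiber at x, with a smooth local frame around every
   point. The sections of a frame are taken to be restrictions of global ones,
   which is no loss, by bump functions, up to shrinking U. *)
Definition subbundle (p : nat)
    (L : forall x : M, set (bundle_fiber x)) : Prop :=
  (forall x z, L x z -> in_fiber p z) /\
  forall x : M, exists (U : set M) (r : nat) (e : 'I_r -> bundle_section),
    [/\ open U, U x, forall i, Omega p (e i).2
      & forall y, U y -> exists b : 'I_r -> bundle_fiber y,
        [/\ forall i, value_at p (e i) (b i),
            forall z, L y z <-> exists c : 'I_r -> R, z = \sum_i c i *: b i
          & forall c : 'I_r -> R, \sum_i c i *: b i = 0 -> forall i, c i = 0]].

Definition sections (p : nat) (L : forall x : M, set (bundle_fiber x)) :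
    set bundle_section :=
  [set e | Omega p e.2 /\
           forall x, exists2 z : bundle_fiber x, value_at p e z & L x z].

Definition pairing (x : M) (z1 z2 : bundle_fiber x) : seq (tangent x) -> R^o :=
  interior_product z1.1 z2.2 + interior_product z2.1 z1.2.

Definition isotropic (L : forall x : M, set (bundle_fiber x)) : Prop :=
  forall x z1 z2, L x z1 -> L x z2 -> pairing z1 z2 = 0.

Definition dorfman (e1 e2 : bundle_section) : bundle_section :=
  (vf_bracket e1.1 e2.1,
   lie_derivative e1.1 e2.2 - interior_product e2.1 (dR e1.2)).

Definition dorfman_involutive (p : nat)
    (L : forall x : M, set (bundle_fiber x)) : Prop :=
  forall e1 e2, sections p L e1 -> sections p L e2 ->
    sections p L (dorfman e1 e2).

Definition ham_vfield (p : nat) (L : forall x : M, set (bundle_fiber x))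
    (w : cochain M) (X : vfield M) : Prop :=
  sections p L (X, dR w).

Definition Omega_ham (p : nat) (L : forall x : M, set (bundle_fiber x)) :
    set (cochain M) :=
  [set w | Omega p.-1 w /\ exists X, ham_vfield p L w X].

Definition ham_complex (p : nat) (L : forall x : M, set (bundle_fiber x))
    (i : int) : set (cochain M) :=
  if i == 0 then Omega_ham p L
  else if 1 - p%:Z <= i < 0 then Omega (absz (p%:Z - 1 + i))
  else [set 0].

End HigherCourant.

(* The graded vector space is the internal direct sum of a family of subspaces
   V i of a module W, and the n-ary bracket is the restriction of l to the
   lists of length n. *)

Section LInfinity.
Context {K : fieldType} {W : lmodType K}.
Implicit Types (V : int -> set W) (l : seq W -> W).

Definition subspace (S : set W) : Prop :=
  S 0 /\ forall (a : K) u v, S u -> S v -> S (a *: u + v).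

Definition independent V : Prop :=
  forall (r : seq int) (u : int -> W), uniq r -> (forall i, V i (u i)) ->
    \sum_(i <- r) u i = 0 -> forall i, i \in r -> u i = 0.

Definition total_space V : set W :=
  [set w | exists (r : seq int) (u : int -> W),
    (forall i, V i (u i)) /\ w = \sum_(i <- r) u i].

Definition homogeneous V (w : W) : Prop := exists i, V i w.

Definition unshuffle (n i : nat) (sigma : 'S_n) : bool :=
  [forall a : 'I_n, forall b : 'I_n,
    (a < b)%N && ((b < i)%N || (i <= a)%N) ==> (sigma a < sigma b)%N].

Definition koszul_sign (n : nat) (deg : 'I_n -> int) (sigma : 'S_n) : K :=
  \prod_(a < n) \prod_(b < n | (a < b)%N && (sigma b < sigma a)%N)
    (-1) ^+ (`|deg (sigma a)| * `|deg (sigma b)|)%N.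

Definition chi (n : nat) (deg : 'I_n -> int) (sigma : 'S_n) : K :=
  (-1) ^+ sigma * koszul_sign deg sigma.

Definition multilinear V l : Prop :=
  forall (s1 s2 : seq W) (a : K) (u v : W),
    (forall w, w \in u :: v :: s1 ++ s2 -> total_space V w) ->
    l (s1 ++ (a *: u + v) :: s2) = a *: l (s1 ++ u :: s2) + l (s1 ++ v :: s2).

Definition has_degree V l : Prop :=
  forall (n : nat) (deg : 'I_n -> int) (v : 'I_n -> W), (0 < n)%N ->
    (forall i, V (deg i) (v i)) ->
    V (\sum_i deg i + 2 - n%:Z) (l [seq v i | i <- enum 'I_n]).

Definition graded_skew V l : Prop :=
  forall (s1 s2 : seq W) (i j : int) (x y : W),
    (forall w, w \in s1 ++ s2 -> homogeneous V w) -> V i x -> V j y ->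
    l (s1 ++ x :: y :: s2) =
      - ((-1) ^+ (`|i| * `|j|)%N *: l (s1 ++ y :: x :: s2)).

(* With i + j = n + 1, the exponent i * (j - 1) is i * (n - i). *)
Definition jacobi_identities V l : Prop :=
  forall (n : nat) (deg : 'I_n -> int) (v : 'I_n -> W), (0 < n)%N ->
    (forall i, V (deg i) (v i)) ->
    \sum_(1 <= i < n.+1) \sum_(sigma : 'S_n | unshuffle i sigma)
      (let s := [seq v (sigma a) | a <- enum 'I_n] in
       (chi deg sigma * (-1) ^+ (i * (n - i))%N) *:
         l (l (take i s) :: drop i s)) = 0.

Definition Linfty_algebra V l : Prop :=
  [/\ forall i, subspace (V i), independent V
    & [/\ multilinear V l, has_degree V l, graded_skew V l
        & jacobi_identities V l]].

Definition Lie_p_algebra (p : nat) V l : Prop :=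
  Linfty_algebra V l /\
  forall i : int, ~~ (1 - p%:Z <= i <= 0) -> V i = [set 0].

End LInfinity.

Definition eps (K : pzRingType) (k : nat) : K :=
  (-1) ^+ (if odd k then (k.-1)./2 else k./2.+1).

(* Main.v *)
Require Import Defs.
From mathcomp Require Import all_boot all_order all_algebra.
From mathcomp Require Import all_classical all_reals all_analysis.
From mathcomp Require Import perm ring zify.

Set Implicit Arguments.
Unset Strict Implicit.
Unset Printing Implicit Defensive.

Import Order.TTheory GRing.Theory Num.Theory.

Local Open Scope classical_set_scope.
Local Open Scope ring_scope.

(** Every bracket is a contraction of an exact form.  If [X_i] is Hamiltonian for
[a_i], isotropy of [L] gives [iota_{X_1} d a_2 = - iota_{X_2} d a_1], so, up to
the sign [eps k], [l_k (a_1, .., a_k)] is the contraction of [d a_1] with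
[X_2, .., X_k].  The same identity shows that it depends on the forms only and not
on the chosen fields: two Hamiltonian fields of one form have the same contraction
with [d b] for every Hamiltonian [b] ([ham_indep]).  Skew-symmetry is isotropy for
the first two arguments and skew-symmetry of [d a_1] for the others.  Involutivity
makes [[X_1, X_2]] Hamiltonian for [l_2 (a_1, a_2)] ([ham_bracket]), because
[d iota_{X_1} d a_2 = L_{X_1} d a_2].

Two kinds of terms survive in the Jacobi identity with [n > 2] entries.  An exact form
has the Hamiltonian field [0], hence it contributes nothing to a higher bracket, and
a bracket of more than two forms has negative degree.  So there remain
[l_{n-1} (l_2 (a_i, a_j), ..)] and [d l_n (a_1, .., a_n)], and only for entries that
are all of degree [0].  With [w = d a_1] and [Y_i = X_{i+1}], the first kind equals
[- (L_{Y_j} w)] contracted with the other fields for the pairs that contain [a_1],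
and [w] contracted with [[Y_i, Y_j]] and the other fields for the remaining pairs.
The sum is the expansion ([dR_cat]) of the contraction of [d w] with all the [Y_i],
and it vanishes because [d d = 0].

The Cartan calculus behind this is obtained by induction on the list of arguments.
From Koszul's formula [iota_X d = L_X - d iota_X] ([dR_cons]) on skew cochains, and
from the definition of the Lie derivative [iota_Y L_X = L_X iota_Y - iota_[X,Y]]
([lie_cons]); these two rules determine [d] and [L_X] one argument at a time, and
[d d = 0], [L_X d = d L_X], and the fact that [d w] and [L_X w] are alternating
follow from them. *)

(** * Cartan calculus on cochains *)

Section VectorFieldCalculus.
Context {R : realType} {n : nat} {M : manifold R n}.
Local Notation C := (smoothfun M).
Local Notation iota := interior_product.
Local Notation Lie := lie_derivative.
Implicit Types (X Y Z U : vfield M) (f g a : C) (c : R) (w : cochain M)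
  (s t : seq (vfield M)).

Lemma vfieldP X Y : (forall f, X f = Y f) -> X = Y.
Proof. by move=> h; apply/val_inj/funext. Qed.

Lemma vf0 X : X 0 = 0.
Proof. by apply: (addrI (X 0)); rewrite -vf_add !addr0. Qed.

Lemma vfN X f : X (- f) = - X f.
Proof. by apply: (addrI (X f)); rewrite -vf_add !subrr vf0. Qed.

Lemma vfB X f g : X (f - g) = X f - X g.
Proof. by rewrite vf_add vfN. Qed.

Lemma vfZ X c f : X (c *: f) = c *: X f.
Proof. by have := vf_linear X c f 0; rewrite vf0 !addr0. Qed.

Lemma vf_addE X Y f : (X + Y) f = X f + Y f.
Proof. by []. Qed.
Lemma vf_oppE X f : (- X) f = - X f.
Proof. by []. Qed.
Lemma vf_zeroE f : (0 : vfield M) f = 0.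
Proof. by []. Qed.
Lemma vf_scaleE a X f : (a *: X) f = a * X f.
Proof. by []. Qed.
Lemma vf_bracketE X Y f : vf_bracket X Y f = X (Y f) - Y (X f).
Proof. by []. Qed.

Definition vfE := (vf_addE, vf_oppE, vf_zeroE, vf_scaleE, vf_bracketE).

Lemma scale_cst c f : c *: f = sf_cst M c * f.
Proof. by []. Qed.

Lemma vf_bracketC X Y : vf_bracket X Y = - vf_bracket Y X.
Proof. by apply: vfieldP => f; rewrite !vfE opprB. Qed.

Lemma vf_bracket_linearr X a U Y :
  vf_bracket X (a *: U + Y) = a *: vf_bracket X U + (X a *: U + vf_bracket X Y).
Proof.
apply: vfieldP => f; rewrite !vfE vf_add vf_leibniz; ring.
Qed.

Lemma vf_bracket_jacobi X Y Z :
  vf_bracket (vf_bracket X Y) Z =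
    vf_bracket X (vf_bracket Y Z) - vf_bracket Y (vf_bracket X Z).
Proof. by apply: vfieldP => f; rewrite !vfE !vfB; ring. Qed.

(** No length is fixed and skew-symmetry is asked of neighbours only, so these
properties pass from [w] to [w (X, -)]; this is what the inductions on the list of
arguments use.  [OmegaP] compares them with the forms of degree [k]. *)
Definition multilin w := forall s t a U X,
  w (s ++ (a *: U + X) :: t) = a * w (s ++ U :: t) + w (s ++ X :: t).
Definition skew w := forall s t X Y,
  w (s ++ X :: Y :: t) = - w (s ++ Y :: X :: t).
Definition alternating_cochain w := multilin w /\ skew w.

Lemma lie_nil X w : Lie X w [::] = X (w [::]).
Proof. by rewrite /lie_derivative big_ord0 subr0. Qed.

(** The commutation rule [iota_Y L_X = L_X iota_Y - iota_[X,Y]].  It is the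
definition of the Lie derivative with the first summand split off, so it holds for
arbitrary cochains, and it turns every statement on [L_X] into an induction. *)
Lemma lie_cons X w Y s :
  Lie X w (Y :: s) = Lie X (iota Y w) s - w (vf_bracket X Y :: s).
Proof.
rewrite /lie_derivative /= big_ord_recl /= drop0 [in LHS]opprD addrA.
by rewrite [in RHS]addrAC.
Qed.

Lemma cochain_addE w v s : (w + v) s = w s + v s.
Proof. by []. Qed.
Lemma cochain_oppE w s : (- w) s = - w s.
Proof. by []. Qed.
Lemma cochain_scaleE c w s : (c *: w) s = c *: w s.
Proof. by []. Qed.
Definition cochainE := (cochain_addE, cochain_oppE, cochain_scaleE).

Lemma lie_mulD X a w v s :
  Lie X (fun t => a * w t + v t) s = a * Lie X w s + X a * w s + Lie X v s.
Proof.
elim: s w v => [|Y s IH] w v.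
  by rewrite !lie_nil vf_add vf_leibniz; ring.
by rewrite !lie_cons (IH (iota Y w) (iota Y v)) /iota; ring.
Qed.

Lemma vf_one X : X 1 = 0.
Proof. by apply: (addrI (X 1)); rewrite addr0 -{3}[1]mulr1 vf_leibniz !mul1r. Qed.

(** A derivation kills constants, hence [L_X] is linear over the reals. *)
Lemma vf_cst X c : X (sf_cst M c) = 0.
Proof. by rewrite -[sf_cst M c]mulr1 -scale_cst vfZ vf_one scaler0. Qed.

Lemma lie_scaleD X c w v : Lie X (c *: w + v) = c *: Lie X w + Lie X v.
Proof.
apply/funext => s; rewrite (lie_mulD X (sf_cst M c) w v s) vf_cst mul0r addr0.
by [].
Qed.

Lemma lieD X w v : Lie X (w + v) = Lie X w + Lie X v.
Proof. by have := lie_scaleD X 1 w v; rewrite !scale1r. Qed.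

Lemma lie0 X : Lie X 0 = 0.
Proof. by apply: (addrI (Lie X 0)); rewrite -lieD !addr0. Qed.

Lemma lieZ X c w : Lie X (c *: w) = c *: Lie X w.
Proof. by have := lie_scaleD X c w 0; rewrite lie0 !addr0. Qed.

Lemma lieN X w : Lie X (- w) = - Lie X w.
Proof. by rewrite -scaleN1r lieZ scaleN1r. Qed.

Lemma lieB X w v : Lie X (w - v) = Lie X w - Lie X v.
Proof. by rewrite lieD lieN. Qed.

Lemma dR_nil w : dR w [::] = 0.
Proof. by rewrite /dR !big_ord0 addr0. Qed.

Lemma dR_scaleD c w v : dR (c *: w + v) = c *: dR w + dR v.
Proof.
apply/funext => s; rewrite -[RHS]/(c *: dR w s + dR v s) /dR.
rewrite scalerDr addrACA !scaler_sumr.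
congr (_ + _); rewrite -big_split; apply: eq_bigr => i _ /=.
  by rewrite vf_linear mulrDr !scale_cst; congr (_ + _); ring.
rewrite scaler_sumr -big_split /=; apply: eq_bigr => j _.
by rewrite fctE -[(c *: w) _]/(c *: w _) !scale_cst; ring.
Qed.

Lemma dRD w v : dR (w + v) = dR w + dR v.
Proof. by have := dR_scaleD 1 w v; rewrite !scale1r. Qed.

Lemma dR0 : dR (0 : cochain M) = 0.
Proof. by apply: (addrI (dR 0)); rewrite -dRD !addr0. Qed.

Lemma dRZ c w : dR (c *: w) = c *: dR w.
Proof. by have := dR_scaleD c w 0; rewrite dR0 !addr0. Qed.

Lemma dRN w : dR (- w) = - dR w.
Proof. by rewrite -scaleN1r dRZ scaleN1r. Qed.

Lemma dRB w v : dR (w - v) = dR w - dR v.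
Proof. by rewrite dRD dRN. Qed.

Lemma alternating_iota X w : alternating_cochain w -> alternating_cochain (iota X w).
Proof.
move=> [lw sw]; split=> [s t a U Y|s t U Y]; rewrite /iota.
  exact: (lw (X :: s)).
exact: (sw (X :: s)).
Qed.

Lemma iota_swap X Y w : skew w -> iota X (iota Y w) = - iota Y (iota X w).
Proof. by move=> sw; apply/funext => s; apply: (sw [::]). Qed.

Lemma alt_oppl w s t X : multilin w -> w (s ++ (- X) :: t) = - w (s ++ X :: t).
Proof.
move=> lw; have := lw s t (-1) X 0; rewrite scaleN1r addr0 => ->.
have := lw s t (-1) 0 0; rewrite scaler0 addr0 mulN1r addNr => ->.
by rewrite mulN1r addr0.
Qed.

Lemma alt_addl w s t X Y :
  multilin w -> w (s ++ (X + Y) :: t) = w (s ++ X :: t) + w (s ++ Y :: t).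
Proof. by move=> lw; have := lw s t 1 X Y; rewrite scale1r mul1r. Qed.

(** Only the first slot of the list needs an argument.  There the summand
[X(a) w(U, ..)] produced by the Leibniz rule cancels against the same summand in
[w([X, a U + Y], ..)]. *)
Lemma alternating_lie X w : alternating_cochain w -> alternating_cochain (Lie X w).
Proof.
move=> aw; split=> [s|s].
  elim: s w aw => [|Z s IH] w aw t a U Y /=; last first.
    rewrite !lie_cons IH; last exact: alternating_iota.
    by rewrite (aw.1 (_ :: s)) /=; ring.
  rewrite !lie_cons.
  have -> : iota (a *: U + Y) w = fun t => a * iota U w t + iota Y w t.
    by apply/funext => r; apply: (aw.1 [::]).
  rewrite lie_mulD vf_bracket_linearr.
  have /= -> := aw.1 [::] t a (vf_bracket X U) (X a *: U + vf_bracket X Y).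
  have /= -> := aw.1 [::] t (X a) U (vf_bracket X Y).
  by rewrite /iota; ring.
elim: s w aw => [|Z s IH] w aw t U Y /=; last first.
  rewrite !lie_cons IH; last exact: alternating_iota.
  by rewrite (aw.2 (_ :: s)) /=; ring.
rewrite !lie_cons (iota_swap _ _ aw.2) lieN /iota fctE.
have /= -> := aw.2 [::] t (vf_bracket X Y) U.
have /= -> := aw.2 [::] t (vf_bracket X U) Y.
by ring.
Qed.

Lemma skew_shift w s t u X :
  skew w -> w (u ++ X :: s ++ t) = (-1) ^+ size s * w (u ++ s ++ X :: t).
Proof.
move=> sw; elim: s u => [|Y s IH] u; first by rewrite expr0 mul1r.
by rewrite /= sw exprS -cat_rcons IH cat_rcons; ring.
Qed.

(** Cartan's magic formula.  In Koszul's formula for [dw(X, s)] the terms that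
involve [X] form [L_X w], once [[X, s_j]] is moved back to the position of [s_j];
in the others [X] is carried past the bracket [[s_i, s_j]], which changes the
sign and leaves [- d (iota_X w)]. *)
Lemma dR_cons X w s :
  skew w -> dR w (X :: s) = Lie X w s - dR (iota X w) s.
Proof.
move=> sw; rewrite /dR /lie_derivative /= !big_ord_recl big_ord0 add0r /=.
rewrite /delete_nth /= drop0 expr0 mul1r.
rewrite -[in RHS]addrA -[LHS]addrA; congr (_ + _).
rewrite opprD addrCA; congr (_ + _).
  rewrite -sumrN; apply: eq_bigr => i _.
  by rewrite /bump /= add1n exprS mulN1r mulNr.
rewrite -!sumrN -big_split; apply: eq_bigr => j _.
rewrite big_ord_recl /= /bump /= !add1n !add0n; congr (_ + _).
  rewrite drop0.
  have /= -> := skew_shift (take j s) (drop j.+1 s) [::] (vf_bracket X s`_j) sw.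
  rewrite size_takel 1?ltnW // exprS mulN1r mulNr mulrA -exprD addnn.
  by rewrite -signr_odd odd_double mul1r.
rewrite -sumrN; apply: eq_bigr => i _.
rewrite /bump /= !add1n addnS addSn !exprS /iota /=.
rewrite (sw [::]) /=; ring.
Qed.

(** Behind the first slot this is inductive by Cartan's formula.  For the first two
slots Cartan's formula is used twice: [iota_Y iota_X d] equals
[iota_Y L_X - L_Y iota_X + d iota_Y iota_X], that is
[L_X iota_Y - L_Y iota_X - iota_[X,Y] + d iota_Y iota_X], which is skew in [X] and
[Y]. *)
Lemma skew_dR w : alternating_cochain w -> skew (dR w).
Proof.
move=> aw s; elim: s w aw => [|Z s IH] w aw t U Y /=.
  rewrite !dR_cons ?lie_cons //; try exact: aw.2; last 2 first.
  - exact: (alternating_iota Y aw).2.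
  - exact: (alternating_iota U aw).2.
  rewrite (iota_swap _ _ aw.2) dRN vf_bracketC fctE.
  have /= -> := alt_oppl [::] t (vf_bracket Y U) aw.1.
  by ring.
have aiw := alternating_iota Z aw.
rewrite !(@dR_cons _ w); try exact: aw.2.
by rewrite (alternating_lie Z aw).2 IH //; ring.
Qed.

(** Cartan's formula reduces every slot but the first to a shorter list.  In the
first slot its two summands are not linear over functions separately, so that slot
is exchanged with the second one. *)
Lemma multilin_dR w : alternating_cochain w -> multilin (dR w).
Proof.
move=> aw s; elim: s w aw => [|Z s IH] w aw t a U Y /=; last first.
  have aiw := alternating_iota Z aw.
  rewrite !dR_cons; try exact: aw.2.
  by rewrite (alternating_lie Z aw).1 IH //; ring.
elim: t w aw => [|Z t IH] w aw.
  rewrite !dR_cons; try exact: aw.2.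
  by rewrite !lie_nil !dR_nil !subr0.
have skd := skew_dR aw.
(* The slot in question is moved behind [Z]; Cartan's formula then applies to [Z]. *)
have /= -> := skd [::] t (a *: U + Y) Z.
have /= -> := skd [::] t U Z.
have /= -> := skd [::] t Y Z.
rewrite !(dR_cons Z); try exact: aw.2.
have /= -> := (alternating_lie Z aw).1 [::] t a U Y.
by rewrite IH //; [ring | exact: alternating_iota].
Qed.

Lemma alternating_dR w : alternating_cochain w -> alternating_cochain (dR w).
Proof. by move=> aw; split; [exact: multilin_dR | exact: skew_dR]. Qed.

Lemma iota_lie X Y w :
  iota Y (Lie X w) = Lie X (iota Y w) - iota (vf_bracket X Y) w.
Proof. by apply/funext => s; exact: lie_cons. Qed.

Lemma iota_dR X w : skew w -> iota X (dR w) = Lie X w - dR (iota X w).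
Proof. by move=> sw; apply/funext => s; exact: dR_cons. Qed.

(** The induction step is the Jacobi identity of vector fields. *)
Lemma lie_bracket X Y w : alternating_cochain w ->
  Lie (vf_bracket X Y) w = Lie X (Lie Y w) - Lie Y (Lie X w).
Proof.
move=> aw; apply/funext => s; elim: s w aw => [|Z s IH] w aw.
  by rewrite !cochainE !lie_nil.
rewrite !cochainE !lie_cons (IH _ (alternating_iota Z aw)) !iota_lie.
rewrite (lieB X (Lie Y (iota Z w))) (lieB Y (Lie X (iota Z w))).
rewrite vf_bracket_jacobi (alt_addl [::] _ _ _ aw.1) (alt_oppl [::] _ _ aw.1).
by rewrite !cochainE /interior_product /=; ring.
Qed.

(** Contraction of [L_X d - d L_X] with [Y] gives [- (L_X d - d L_X) iota_Y] up to
[[L_X, L_Y] - L_[X,Y] = 0]. *)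
Lemma lie_dR X w : alternating_cochain w -> Lie X (dR w) = dR (Lie X w).
Proof.
move=> aw; apply/funext => s; elim: s w aw => [|Y s IH] w aw.
  by rewrite lie_nil !dR_nil vf0.
have aiw := alternating_iota Y aw.
rewrite lie_cons !dR_cons; [|exact: (alternating_lie X aw).2|exact: aw.2].
rewrite iota_dR ?iota_lie; last exact: aw.2.
rewrite (lieB X (Lie Y w)) (dRB (Lie X (iota Y w))) lie_bracket //.
by rewrite !cochainE (IH _ aiw); ring.
Qed.

(** By Cartan's formula [iota_X d d = L_X d - d L_X + d d iota_X]. *)
Lemma dR_dR w : alternating_cochain w -> dR (dR w) = 0.
Proof.
move=> aw; apply/funext => s; elim: s w aw => [|X s IH] w aw.
  by rewrite dR_nil.
rewrite dR_cons; last exact: (alternating_dR aw).2.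
rewrite lie_dR // iota_dR; last exact: aw.2.
rewrite (dRB (Lie X w)) !cochainE (IH _ (alternating_iota X aw)).
by rewrite oppr0 addr0 subrr.
Qed.

End VectorFieldCalculus.

(** * Iterated contractions and forms of a fixed degree *)

Section Forms.
Context {R : realType} {n : nat} {M : manifold R n}.
Local Notation C := (smoothfun M).
Local Notation iota := interior_product.
Local Notation Lie := lie_derivative.
Implicit Types (X Y Z U : vfield M) (f g a : C) (c : R) (w : cochain M)
  (s t : seq (vfield M)) (k : nat).

(** Repeated use of Cartan's formula and of [iota_Y L_X = L_X iota_Y - iota_[X,Y]]
on the arguments [s].  When [dw = 0] this computes the differential of the
contraction of [w] with [s]; for [w = d a_1] that is the Jacobi identity of the
brackets. *)
Lemma dR_cat w s t : alternating_cochain w ->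
  dR w (s ++ t) =
    \sum_(i < size s) (-1) ^+ i * Lie (nth 0 s i) w (delete_nth i s ++ t)
    - \sum_(j < size s) \sum_(i < j) (-1) ^+ (i + j) *
        w (vf_bracket (nth 0 s i) (nth 0 s j)
             :: delete_nth i (delete_nth j s) ++ t)
    + (-1) ^+ size s * dR (fun u => w (s ++ u)) t.
Proof.
elim: s w => [|Y s IH] w aw.
  by rewrite !big_ord0 /= subr0 add0r expr0 mul1r.
rewrite /= dR_cons ?(IH _ (alternating_iota Y aw)); last exact: aw.2.
rewrite !big_ord_recl big_ord0 add0r /delete_nth /= drop0 expr0 mul1r.
rewrite exprS mulN1r mulNr opprD addrA; congr (_ - _).
rewrite -[in RHS]addrA; congr (_ + _).
rewrite -!sumrN -!big_split -sumrN; apply: eq_bigr => j _ /=.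
rewrite big_ord_recl /bump /= drop0 !add1n add0n lie_cons vf_bracketC.
rewrite (alt_oppl [::] _ _ aw.1) opprD opprK.
have -> : \sum_(i < j) (-1) ^+ (i + j) * iota Y w (vf_bracket s`_i s`_j ::
      delete_nth i (delete_nth j s) ++ t) =
    - \sum_(i < j) (-1) ^+ (bump 0 i + j.+1) *
      w (vf_bracket s`_i s`_j :: Y :: delete_nth i (delete_nth j s) ++ t).
  rewrite -sumrN; apply: eq_bigr => i _.
  by rewrite /bump add1n addnS addSn !exprS /iota [in RHS](aw.2 [::]) /=; ring.
by rewrite !exprS /iota /delete_nth; ring.
Qed.

Lemma size_delete_nth (T : Type) i (s : seq T) :
  (i < size s)%N -> size (delete_nth i s) = (size s).-1.
Proof.
by move=> h; rewrite size_cat size_takel ?(ltnW h) // size_drop; lia.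
Qed.

(** Smooth functions form a real vector space, so there is no 2-torsion, and
skew-symmetry of neighbours implies that a form vanishes on repeated arguments. *)
Lemma addrr_eq0 f : f + f = 0 -> f = 0.
Proof.
move=> h; have /eqP : (2%:R : R) *: f = 0 by rewrite scaler_nat mulr2n.
by rewrite scaler_eq0 pnatr_eq0 => /eqP.
Qed.

Lemma OmegaP k w :
  Omega k w <-> alternating_cochain w /\ forall s, size s != k -> w s = 0.
Proof.
split=> [[sw lw aw]|[[lw kw] sw]].
  split=> //; split=> // s t X Y; have := aw s [::] t (X + Y).
  rewrite /= alt_addl // -cat_rcons alt_addl // -[in X in _ + X = _]cat_rcons.
  rewrite alt_addl // !cat_rcons.
  rewrite (aw s [::] t X : w _ = 0) (aw s [::] t Y : w _ = 0).
  by rewrite add0r addr0 => /eqP; rewrite addr_eq0 => /eqP ->.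
split=> // s1 s2 s3 X.
rewrite (skew_shift _ _ _ _ kw) catA.
by rewrite [w _]addrr_eq0 ?mulr0 // {1}kw addNr.
Qed.

Lemma Omega_alternating k w : Omega k w -> alternating_cochain w.
Proof. by case/OmegaP. Qed.

Lemma Omega_support k w s : Omega k w -> size s != k -> w s = 0.
Proof. by case=> h _ _; exact: h. Qed.

Lemma Omega0 k : Omega k (0 : cochain M).
Proof. by split=> // s t a U X; rewrite -[RHS]/(a * 0 + 0) mulr0 addr0. Qed.

Lemma Omega_scaleD k c w v : Omega k w -> Omega k v -> Omega k (c *: w + v).
Proof.
move=> [sw lw aw] [sv lv av]; split=> [s hs|s t a U X|s1 s2 s3 X].
- by rewrite !cochainE sw // sv // scaler0 addr0.
- by rewrite !cochainE lw lv !scale_cst; ring.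
- by rewrite !cochainE aw av scaler0 addr0.
Qed.

Lemma OmegaN k w : Omega k w -> Omega k (- w).
Proof.
by move=> h; have := Omega_scaleD (-1) h (Omega0 k); rewrite addr0 scaleN1r.
Qed.

Lemma OmegaZ k c w : Omega k w -> Omega k (c *: w).
Proof. by move=> h; have := Omega_scaleD c h (Omega0 k); rewrite addr0. Qed.

Lemma Omega_iota k X w : Omega k.+1 w -> Omega k (iota X w).
Proof.
move=> /OmegaP[aw sw]; apply/OmegaP; split; first exact: alternating_iota.
by move=> s hs; apply: sw; rewrite /= eqSS.
Qed.

Lemma Omega_dR k w : Omega k w -> Omega k.+1 (dR w).
Proof.
move=> /OmegaP[aw sw]; apply/OmegaP; split; first exact: alternating_dR.
move=> s hs; rewrite /dR !big1 ?addr0 // => j _.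
  rewrite big1 // => i _; rewrite sw ?mulr0 //= size_delete_nth size_delete_nth //.
    by move: (ltn_ord i) (ltn_ord j) hs; lia.
  by move: (ltn_ord i) (ltn_ord j) hs; lia.
rewrite sw ?vf0 ?mulr0 // size_delete_nth //.
by move: (ltn_ord j) hs; lia.
Qed.

End Forms.

(** * Sections of an isotropic involutive subbundle *)

Section Hamiltonian.
Context {R : realType} {n : nat} {M : manifold R n}.
Context {p : nat} {L : forall x : M, set (bundle_fiber x)}.
Arguments L : clear implicits.
Local Notation C := (smoothfun M).
Local Notation iota := interior_product.
Local Notation Lie := lie_derivative.
Local Notation ham := (ham_vfield p L).
Implicit Types (X Y Z U : vfield M) (f g a : C) (c : R) (w v : cochain M)
  (s t : seq (vfield M)) (k : nat) (e : bundle_section M).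

Context (subL : subbundle p L).

Lemma subbundle0 x : L x 0.
Proof.
have [U [r [e [_ Ux _ /(_ x Ux)[b [_ Lb _]]]]]] := subL.2 x.
by apply/Lb; exists (fun=> 0); rewrite big1 // => i _; rewrite scale0r.
Qed.

Lemma subbundle_scaleD x c (z1 z2 : bundle_fiber x) :
  L x z1 -> L x z2 -> L x (c *: z1 + z2).
Proof.
have [U [r [e [_ Ux _ /(_ x Ux)[b [_ Lb _]]]]]] := subL.2 x.
move=> /Lb[c1 ->] /Lb[c2 ->]; apply/Lb; exists (fun i => c * c1 i + c2 i).
rewrite scaler_sumr -big_split; apply: eq_bigr => i _.
by rewrite scalerDl scalerA.
Qed.

(** The zero section lies in [L], which makes [0] a Hamiltonian field of every
closed form. *)
Lemma sections0 : sections p L (0, 0).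
Proof.
split=> [|x]; first exact: Omega0.
have L0 := subbundle0 x; exists 0 => //; split=> //; last exact: subL.1 L0.
by apply: val_inj; apply/funext.
Qed.

Lemma sections_scaleD c e1 e2 : sections p L e1 -> sections p L e2 ->
  sections p L (sf_cst M c *: e1.1 + e2.1, c *: e1.2 + e2.2).
Proof.
move=> [Om1 h1] [Om2 h2]; split=> [|x]; first exact: Omega_scaleD.
have [z1 [a1 _ b1] Lz1] := h1 x; have [z2 [a2 _ b2] Lz2] := h2 x.
have Lz := subbundle_scaleD c Lz1 Lz2.
exists (c *: z1 + z2) => //; split; last 2 first.
- exact: subL.1 Lz.
- by move=> s; rewrite /= -[LHS]/(c * z1.2 _ + z2.2 _) b1 b2.
by rewrite /= a1 a2; apply: val_inj; apply/funext.
Qed.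

Lemma ham0 : ham 0 0.
Proof. by rewrite /ham_vfield dR0; exact: sections0. Qed.

Lemma ham_scaleD c w v X Y :
  ham w X -> ham v Y -> ham (c *: w + v) (sf_cst M c *: X + Y).
Proof.
by move=> hw hv; rewrite /ham_vfield dR_scaleD; exact: (sections_scaleD c hw hv).
Qed.

Lemma Omega_ham_subspace : Defs.subspace (Omega_ham p L).
Proof.
split; first by split; [exact: Omega0 | exists (0 : vfield M); exact: ham0].
move=> c u v [Ou [X hX]] [Ov [Y hY]].
by split; [exact: Omega_scaleD | exists (sf_cst M c *: X + Y); exact: ham_scaleD].
Qed.

Lemma ham_dR w : alternating_cochain w -> ham (dR w) 0.
Proof. by move=> aw; rewrite /ham_vfield dR_dR //; exact: sections0. Qed.

Context (isoL : isotropic L).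

(** Isotropy is a statement at each point; values of sections transport it to
smooth functions. *)
Lemma sections_pairing e1 e2 s : sections p L e1 -> sections p L e2 ->
  e2.2 (e1.1 :: s) = - e1.2 (e2.1 :: s).
Proof.
move=> [_ h1] [_ h2]; apply/eqP; rewrite -addr_eq0; apply/eqP.
apply: val_inj; apply/funext => x.
have [z1 [a1 _ b1] Lz1] := h1 x; have [z2 [a2 _ b2] Lz2] := h2 x.
have := congr1 (fun h => h (map (vf_at x) s)) (isoL Lz1 Lz2).
rewrite /pairing -[LHS]/(z2.2 (z1.1 :: _) + z1.2 (z2.1 :: _)).
by rewrite a1 a2 -!map_cons b1 b2.
Qed.

Lemma ham_skew w v X Y s : ham w X -> ham v Y ->
  dR v (X :: s) = - dR w (Y :: s).
Proof. by move=> hw hv; have := sections_pairing s hw hv. Qed.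

(** Moved to the front, the argument [X] contributes [iota_X d w = - iota_Y d v] by
isotropy, and the right-hand side does not mention [X]. *)
Lemma ham_indep w v X X' Y s t : alternating_cochain w ->
  ham w Y -> ham v X -> ham v X' ->
  dR w (s ++ X :: t) = dR w (s ++ X' :: t).
Proof.
move=> aw hw hX hX'.
have front U : dR w (s ++ U :: t) = (-1) ^+ size s * dR w (U :: s ++ t).
  have /= -> := skew_shift s t [::] U (skew_dR aw).
  by rewrite mulrA -exprD addnn -signr_odd odd_double mul1r.
by rewrite !front (ham_skew _ hX hw) (ham_skew _ hX' hw).
Qed.

Lemma ham_indep_map (I : Type) (r : seq I) (F G : I -> vfield M) w Y s t :
  alternating_cochain w -> ham w Y ->
  (forall i, exists v, ham v (F i) /\ ham v (G i)) ->
  dR w (s ++ map F r ++ t) = dR w (s ++ map G r ++ t).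
Proof.
move=> aw hw FG; elim: r s => [|i r IH] s //=.
have [v [hF hG]] := FG i.
by rewrite (ham_indep _ _ aw hw hF hG) -cat_rcons IH cat_rcons.
Qed.

Context (invL : dorfman_involutive p L).

(** Since [d d v = 0], the Dorfman bracket of [X + d w] and [Y + d v] is
[[X, Y] + L_X d v], and [L_X d v = d (iota_X d v)] by Cartan's formula. *)
Lemma ham_bracket w v X Y : alternating_cochain w -> alternating_cochain v ->
  ham w X -> ham v Y -> ham (iota X (dR v)) (vf_bracket X Y).
Proof.
move=> aw av hw hv; have := invL hw hv.
rewrite /dorfman /= dR_dR // /ham_vfield.
have -> : dR (iota X (dR v)) = Lie X (dR v).
  have := iota_dR X (alternating_dR av).2.
  by rewrite dR_dR // => /esym/eqP; rewrite subr_eq0 => /eqP.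
by rewrite [_ - _](_ : _ = Lie X (dR v)) //; apply/funext => s; exact: subr0.
Qed.

End Hamiltonian.

(** * Sums over unshuffles *)

Section Unshuffles.

(** A strictly increasing [s] satisfies [a <= s a]; the inverse is strictly
increasing as well, which gives the converse inequality. *)
Lemma monotone_perm1 n (s : 'S_n) :
  (forall a b : 'I_n, (a < b)%N -> (s a < s b)%N) -> s = 1%g.
Proof.
have le_perm (t : 'S_n) :
    (forall a b : 'I_n, (a < b)%N -> (t a < t b)%N) ->
    forall a : 'I_n, (a <= t a)%N.
  move=> mono [k]; elim: k => // k IH lt_kn.
  have lt_k : (k < n)%N by exact: ltnW.
  exact: leq_ltn_trans (IH lt_k) (mono (Ordinal lt_k) (Ordinal lt_kn) _).
move=> mono; apply/permP => a; rewrite perm1; apply/val_inj/eqP => /=.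
rewrite eqn_leq (le_perm s mono) andbT.
suff monoV : forall b c : 'I_n, (b < c)%N -> ((s^-1)%g b < (s^-1)%g c)%N.
  by have := le_perm _ monoV (s a); rewrite permK.
move=> b c bc; rewrite ltnNge leq_eqVlt; apply/negP => /orP[/eqP|] h.
  by move: bc; rewrite -(permKV s c) (val_inj h) permKV ltnn.
by have := mono _ _ h; rewrite !permKV; move: bc; lia.
Qed.

Lemma unshuffle_trivial n i (s : 'S_n) : (i == 0) || (i == n) ->
  unshuffle i s = (s == 1%g).
Proof.
move=> hi; apply/idP/eqP => [/forallP us|->].
  apply: monotone_perm1 => a b ab; have /forallP/(_ b)/implyP := us a; apply.
  by case/orP: hi => /eqP ->; rewrite ab ?leq0n ?orbT ?ltn_ord.
by apply/forallP => a; apply/forallP => b; rewrite !perm1; apply/implyP => /andP[].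
Qed.

Lemma lt_lift n (a : 'I_n.+1) (k : 'I_n) : (a < lift a k)%N = (a <= k)%N.
Proof. by rewrite /= /bump; case: leqP => h; lia. Qed.

Lemma lift_mono n (a : 'I_n.+1) (j k : 'I_n) :
  (lift a j < lift a k)%N = (j < k)%N.
Proof. by rewrite /= /bump; case: leqP; case: leqP; lia. Qed.

(** [lift_perm ord0 a s] sends the first element to [a] and arranges the others as
[s] does.  It is an unshuffle when [s] is one and [a] precedes the images of the
other elements of the first block. *)
Lemma unshuffle_lift n i (a : 'I_n.+1) (s : 'S_n) :
  unshuffle i.+1 (lift_perm ord0 a s) =
    unshuffle i s && [forall j : 'I_n, (j < i)%N ==> (a <= s j)%N].
Proof.
apply/idP/andP => [/forallP us|[/forallP us /forallP ai]].
  split; last first.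
    apply/forallP => j; apply/implyP => ji.
    have /forallP/(_ (lift ord0 j))/implyP := us ord0.
    by rewrite lift_perm_id lift_perm_lift (lt_lift a); apply; rewrite /= ltnS ji.
  apply/forallP => b; apply/forallP => c; apply/implyP => bc.
  have /forallP/(_ (lift ord0 c))/implyP := us (lift ord0 b).
  by rewrite !lift_perm_lift !lift_mono; apply.
apply/forallP => b; apply/forallP => c; apply/implyP.
case: (unliftP ord0 b) => [b'|] ->; case: (unliftP ord0 c) => [c'|] -> //.
- rewrite !lift_perm_lift !lift_mono.
  by have /forallP/(_ c')/implyP := us b'.
- rewrite lift_perm_id lift_perm_lift (lt_lift a) /= orbF.
  by have /implyP := ai c'.
Qed.

(** A permutation is determined by the image of the first element and by the
arrangement of the others. *)
Lemma sum_perm_lift (A : nmodType) n (F : 'S_n.+1 -> A) :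
  \sum_s F s = \sum_a \sum_(s : 'S_n) F (lift_perm ord0 a s).
Proof.
rewrite (partition_big (fun s : 'S_n.+1 => s ord0) predT) //=.
apply: eq_bigr => a _.
rewrite (reindex (lift_perm ord0 a)); last first.
  (* [ulsf i s] is [s] with [i] and its image removed, the inverse of [lift_perm]. *)
  pose ulsf i (s : 'S_n.+1) k := odflt k (unlift (s i) (s (lift i k))).
  have ulsfK i (s : 'S_n.+1) k : lift (s i) (ulsf i s k) = s (lift i k).
    rewrite /ulsf; have:= neq_lift i k.
    by rewrite -(can_eq (permK s)) => /unlift_some[] ? ? ->.
  have inj_ulsf : injective (ulsf ord0 _).
    move=> s; apply: can_inj (ulsf (s ord0) s^-1%g) _ => k'.
    by rewrite {1}/ulsf ulsfK !permK liftK.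
  exists (fun s => perm (inj_ulsf s)) => [s _ | s].
    by apply/permP=> k'; rewrite permE /ulsf lift_perm_lift lift_perm_id liftK.
  move/(s _ =P _) => si0; apply/permP=> k.
  case: (unliftP ord0 k) => [k'|] ->; rewrite ?lift_perm_id //.
  by rewrite lift_perm_lift -si0 permE ulsfK.
by apply: eq_bigl => s; rewrite lift_perm_id eqxx.
Qed.

(** An unshuffle with first block of size two is the choice of a pair: [a] is its
smaller element and [b] the position of the larger one after [a] is removed, so
[a <= b] is the condition that [a] comes first. *)
Lemma sum_unshuffle2 (A : nmodType) n (F : 'S_n.+2 -> A) :
  \sum_(s | unshuffle 2 s) F s =
  \sum_(a < n.+2) \sum_(b < n.+1 | (a <= b)%N)
    F (lift_perm ord0 a (lift_perm ord0 b 1%g)).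
Proof.
rewrite big_mkcond sum_perm_lift; apply: eq_bigr => a _.
rewrite sum_perm_lift [RHS]big_mkcond; apply: eq_bigr => b _.
rewrite -big_mkcond (eq_bigl (fun s : 'S_n => (s == 1%g) && (a <= b)%N)).
  by case: (a <= b)%N; [rewrite (eq_bigl _ _ (fun s => andbT _)) big_pred1_eq|
    rewrite big1 // => s; rewrite andbF].
move=> s; rewrite !unshuffle_lift unshuffle_trivial //.
have -> : [forall j : 'I_n, (j < 0)%N ==> (b <= s j)%N] by apply/forallP.
rewrite andbT; congr (_ && _); apply/forallP/idP => [/(_ ord0)|ab j].
  by rewrite lift_perm_id.
by case: (unliftP ord0 j) => [j'|] ->; rewrite ?lift_perm_id.
Qed.

Lemma map_delete_nth (T U : Type) (f : T -> U) i (s : seq T) :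
  delete_nth i (map f s) = map f (delete_nth i s).
Proof. by rewrite /delete_nth map_cat map_take map_drop. Qed.

Lemma delete_nth0 (T : Type) (x : T) (s : seq T) : delete_nth 0 (x :: s) = s.
Proof. exact: drop0. Qed.

Lemma delete_nthC (T : Type) i j (s : seq T) : (i <= j)%N ->
  delete_nth j (delete_nth i s) = delete_nth i (delete_nth j.+1 s).
Proof.
elim: s i j => [|x s IH] [|i] j ij //; first by rewrite !delete_nth0.
by case: j ij => // j ij; congr (_ :: _); apply: IH.
Qed.

Lemma nth_delete_nth (T : Type) (x0 : T) i j (s : seq T) : (i <= j)%N ->
  nth x0 (delete_nth i s) j = nth x0 s j.+1.
Proof.
elim: s i j => [|x s IH] [|i] j ij; rewrite ?delete_nth0 ?nth_nil //.
by case: j ij => // j ij; apply: IH.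
Qed.

Lemma enum_lift n (a : 'I_n.+1) :
  map (lift a) (enum 'I_n) = delete_nth a (enum 'I_n.+1).
Proof.
apply: (inj_map val_inj); rewrite -map_delete_nth val_enum_ord -map_comp.
rewrite (map_comp (bump a) val) val_enum_ord /delete_nth.
have := ltn_ord a; rewrite ltnS -[n.+1.-1]/n; move: {a}(a : nat) => a an.
rewrite take_iota drop_iota (minn_idPl (leqW an)) add0n subSS.
rewrite -{1}(subnKC an) iotaD map_cat add0n; congr (_ ++ _).
  by rewrite -[RHS]map_id; apply/eq_in_map => k; rewrite mem_iota /bump; lia.
rewrite -[a.+1]add1n iotaDl; apply/eq_in_map => k.
by rewrite mem_iota /bump => /andP[->].
Qed.

Lemma map_lift_perm n (T : Type) (v : 'I_n.+1 -> T) (a : 'I_n.+1) (s : 'S_n) :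
  [seq v (lift_perm ord0 a s k) | k <- enum 'I_n.+1] =
    v a :: [seq v (lift a (s k)) | k <- enum 'I_n].
Proof.
rewrite enum_ordSl /= lift_perm_id -map_comp; congr (_ :: _).
by apply: eq_map => k /=; rewrite lift_perm_lift.
Qed.

Lemma chi_degree0 (K : fieldType) n (s : 'S_n) :
  chi (fun=> 0) s = (-1) ^+ s :> K.
Proof.
by rewrite /chi /koszul_sign big1 ?mulr1 // => a _; rewrite big1.
Qed.

(** The chosen pair is brought to the front by [a + b] transpositions of neighbours. *)
Lemma sum_unshuffle2_seq (K : fieldType) (W : lmodType K) n
    (G : seq W -> W) (v : 'I_n.+2 -> W) (vs : seq W) :
  vs = [seq v k | k <- enum 'I_n.+2] ->
  \sum_(s : 'S_n.+2 | unshuffle 2 s)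
     (-1) ^+ s *: G [seq v (s k) | k <- enum 'I_n.+2] =
  \sum_(a < n.+2) \sum_(b < n.+1 | (a <= b)%N) (-1) ^+ (a + b) *:
    G [:: nth 0 vs a, nth 0 (delete_nth a vs) b
         & delete_nth b (delete_nth a vs)].
Proof.
move=> vsE; rewrite sum_unshuffle2; apply: eq_bigr => a _; apply: eq_bigr => b _.
rewrite !odd_lift_perm odd_perm1 addbF /= -[in RHS]signr_odd oddD; congr (_ *: G _).
rewrite map_lift_perm (map_lift_perm (fun k => v (lift a k))).
have hd : delete_nth a vs = [seq v (lift a k) | k <- enum 'I_n.+1].
  by rewrite vsE map_delete_nth -enum_lift -map_comp.
have nth_enum m (f : 'I_m -> W) (k : 'I_m) :
    nth 0 [seq f x | x <- enum 'I_m] k = f k.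
  by rewrite (nth_map k 0 f) ?size_enum_ord // nth_ord_enum.
rewrite hd vsE (nth_enum _ v) (nth_enum _ (fun k => v (lift a k))).
congr [:: _, _ & _]; rewrite map_delete_nth -enum_lift.
by rewrite -[RHS]map_comp; apply: eq_map => k /=; rewrite perm1.
Qed.

End Unshuffles.

(** * The brackets *)

Section Brackets.
Context {R : realType} {n : nat} {M : manifold R n}.
Context (p : nat) (L : forall x : M, set (bundle_fiber x)).
Arguments L : clear implicits.
Local Notation C := (smoothfun M).
Local Notation iota := interior_product.
Local Notation Lie := lie_derivative.
Local Notation ham := (ham_vfield p L).
Local Notation V := (ham_complex p L).
Implicit Types (X Y Z U : vfield M) (f g a : C) (c : R) (u v w : cochain M)
  (t : seq (vfield M)) (s ws : seq (cochain M)) (k : nat) (i : int).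

(** The component of degree [0]: forms of degree [p - 1] are supported on lists of
that length. *)
Definition top_part w : cochain M :=
  fun t => if size t == p.-1 then w t else 0.

(** The default value matters only outside the Hamiltonian forms; inside them the
brackets do not see the choice. *)
Definition ham_choice w : vfield M := xget 0 [set X | ham (top_part w) X].

(** In the unary bracket the test on the length of [t] discards the differential of
the component of degree [0].  In the others the first form is differentiated; the
minus sign is the one in [iota_{X_1} d a_2 = - iota_{X_2} d a_1]. *)
Definition lbr s : cochain M :=
  match s with
  | [::] => 0
  | [:: w] => fun t => if size t == p then 0 else dR w t
  | w :: ws => - eps R (size s) *:
      fun t => dR (top_part w) (map ham_choice ws ++ t)
  end.

Lemma top_part_scaleD c u v :
  top_part (c *: u + v) = c *: top_part u + top_part v.
Proof.
apply/funext => t; rewrite /top_part !cochainE.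
by case: eqP => _; rewrite ?scaler0 ?addr0.
Qed.

Lemma top_part0 : top_part 0 = 0.
Proof. by apply/funext => t; rewrite /top_part; case: ifP. Qed.

Context (p_ge1 : (1 <= p)%N).
Context (subL : subbundle p L).

Lemma ham_complexP i w : V i w ->
  [\/ i = 0 /\ Omega_ham p L w,
      [/\ i < 0, 1 - p%:Z <= i & Omega (absz (p%:Z - 1 + i)) w] | w = 0].
Proof.
rewrite /ham_complex; case: eqP => [-> h|_]; first by constructor 1.
by case: ifP => [/andP[h1 h2] h|_ ->]; [constructor 2|constructor 3].
Qed.

Lemma ham_complex0 i : V i 0.
Proof.
rewrite /ham_complex; case: ifP => _; first exact: (Omega_ham_subspace subL).1.
by case: ifP => _ //; exact: Omega0.
Qed.

Lemma ham_complex_subspace i : Defs.subspace (V i).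
Proof.
split; first exact: ham_complex0.
rewrite /ham_complex; case: ifP => _; first exact: (Omega_ham_subspace subL).2.
case: ifP => _ c u v; first exact: Omega_scaleD.
by move=> -> ->; rewrite scaler0 addr0.
Qed.

Lemma ham_complex_alternating i w : V i w -> alternating_cochain w.
Proof.
case/ham_complexP => [[_ [h _]]|[_ _ h]|->]; try exact: Omega_alternating h.
exact: Omega_alternating (Omega0 0).
Qed.

Lemma ham_complex_support i w t :
  V i w -> (size t)%:Z != p%:Z - 1 + i -> w t = 0.
Proof.
case/ham_complexP => [[-> [h _]]|[i0 ip h]|-> //] ht; apply: (Omega_support h).
  by apply: contraNneq ht => ->; lia.
by apply: contraNneq ht => ->; lia.
Qed.

(** Forms of different degrees are supported on lists of different lengths. *)
Lemma ham_complex_independent : Defs.independent V.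
Proof.
move=> r u ur Vu su0 i ir; apply/funext => t.
have [ti|ti] := eqVneq (size t)%:Z (p%:Z - 1 + i); last first.
  exact: ham_complex_support (Vu i) ti.
have : (\sum_(j <- r) u j) t = 0 by rewrite su0.
rewrite (bigD1_seq i) //= cochainE.
have -> : (\sum_(j <- r | j != i) u j) t = 0; last by rewrite addr0.
elim/big_rec: _ => // j w ji; rewrite cochainE => ->; rewrite addr0.
apply: ham_complex_support (Vu j) _; rewrite ti.
by apply: contraNneq ji; lia.
Qed.

Lemma top_part_Omega w : Omega p.-1 w -> top_part w = w.
Proof.
move=> h; apply/funext => t; rewrite /top_part.
by case: eqP => // /eqP ht; rewrite (Omega_support h ht).
Qed.

Lemma top_part_neq0 i w : i != 0 -> V i w -> top_part w = 0.
Proof.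
move=> i0 Vw; apply/funext => t; rewrite /top_part; case: eqP => // tp.
by apply: ham_complex_support Vw _; rewrite tp; lia.
Qed.

Lemma Omega_ham_top_part i w : V i w -> Omega_ham p L (top_part w).
Proof.
have [->|i0 Vw] := eqVneq i 0; last first.
  by rewrite (top_part_neq0 i0 Vw); exact: (Omega_ham_subspace subL).1.
by rewrite /ham_complex eqxx => h; rewrite top_part_Omega //; case: h.
Qed.

Lemma ham_complex_deg0 : V 0 = Omega_ham p L.
Proof. by rewrite /ham_complex eqxx. Qed.

Lemma Omega_ham_top_total w : total_space V w -> Omega_ham p L (top_part w).
Proof.
have [S0 SD] := Omega_ham_subspace subL.
move=> [r [u [Vu ->]]]; elim/big_rec: _ => [|i v _ IH].
  by rewrite top_part0.
have := top_part_scaleD 1 (u i) v; rewrite !scale1r => ->.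
rewrite -[top_part (u i)]scale1r; apply: SD => //.
exact: Omega_ham_top_part (Vu i).
Qed.

Lemma ham_choiceP w :
  Omega_ham p L (top_part w) -> ham (top_part w) (ham_choice w).
Proof. by move=> [_ exX]; exact: (xgetPex 0 exX). Qed.

Lemma lbr_cons2 w v ws t : lbr [:: w, v & ws] t =
  - eps R (size ws).+2 *: dR (top_part w) (ham_choice v :: map ham_choice ws ++ t).
Proof. by []. Qed.

Lemma lbr_cons w s t : (0 < size s)%N ->
  lbr (w :: s) t = - eps R (size s).+1 *: dR (top_part w) (map ham_choice s ++ t).
Proof. by case: s. Qed.

Lemma lbr_cat w s1 x s2 t : lbr (w :: s1 ++ x :: s2) t =
  - eps R (size s1 + size s2).+2 *:
    dR (top_part w) (map ham_choice s1 ++ ham_choice x :: map ham_choice s2 ++ t).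
Proof.
by rewrite lbr_cons size_cat addnS // map_cat -catA.
Qed.

Lemma lbr_cons_eq0 w ws : dR (top_part w) = 0 -> (0 < size ws)%N ->
  lbr (w :: ws) = 0.
Proof.
by case: ws => // v ws dw _; apply/funext => t; rewrite lbr_cons2 dw scaler0.
Qed.

Lemma lbr1E i w : V i w -> lbr [:: w] = if i == 0 then 0 else dR w.
Proof.
move=> Vw; apply/funext => t; rewrite [LHS]/=.
case: (ham_complexP Vw) => [[-> [Ow _]]|[i0 ip Ow]|->].
- rewrite eqxx; have [//|tp] := eqVneq (size t) p.
  by rewrite (Omega_support (Omega_dR Ow)) // prednK.
- rewrite (lt_eqF i0); have [tp|//] := eqVneq (size t) p.
  by rewrite (Omega_support (Omega_dR Ow)) // tp; apply/eqP; lia.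
- by rewrite dR0; case: ifP => _; case: ifP.
Qed.

Lemma lbr_0 ws : lbr (0 :: ws) = 0.
Proof.
case: ws => [|v ws]; last by rewrite lbr_cons_eq0 // top_part0 dR0.
by rewrite (lbr1E (ham_complex0 0)) eqxx.
Qed.

Context (isoL : isotropic L).

Lemma Omega_ham_alternating w : Omega_ham p L w -> alternating_cochain w.
Proof. by case=> h _; exact: Omega_alternating h. Qed.

(** Linearity in the first argument is linearity of [d].  In the others the chosen
field of [c *: u + v] is replaced by [c X_u + X_v], which is Hamiltonian for the
same form. *)
Lemma lbr_multilinear : Defs.multilinear V lbr.
Proof.
move=> s1 s2 c u v Vs.
have ou : Omega_ham p L (top_part u).
  by apply: Omega_ham_top_total; apply: Vs; rewrite inE eqxx.
have ov : Omega_ham p L (top_part v).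
  by apply: Omega_ham_top_total; apply: Vs; rewrite !inE eqxx orbT.
case: s1 Vs => [|w s1] Vs.
  case: s2 Vs => [|x s2] _; apply/funext => t.
    rewrite /= dR_scaleD !cochainE; case: eqP => _ //.
    by rewrite scaler0 addr0.
  rewrite [LHS]lbr_cons2 top_part_scaleD dR_scaleD !cochainE !lbr_cons2.
  by rewrite !scalerDr !scalerA [c * _]mulrC.
have ow : Omega_ham p L (top_part w).
  by apply: Omega_ham_top_total; apply: Vs; rewrite !inE eqxx !orbT.
apply/funext => t; rewrite !cochainE !cat_cons !lbr_cat.
have aw := Omega_ham_alternating ow; have hw := ham_choiceP ow.
have ouv : Omega_ham p L (top_part (c *: u + v)).
  by rewrite top_part_scaleD; apply: (Omega_ham_subspace subL).2.
have huv : ham (top_part (c *: u + v))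
    (sf_cst M c *: ham_choice u + ham_choice v).
  by rewrite top_part_scaleD; apply: ham_scaleD => //; exact: ham_choiceP.
rewrite (ham_indep isoL _ _ aw hw (ham_choiceP ouv) huv).
rewrite (alternating_dR aw).1 -scale_cst.
by rewrite scalerDr !scalerA [c * _]mulrC.
Qed.

(** An entry without component of degree [0] has the Hamiltonian field [0]. *)
Lemma lbr_top_eq0 s w : (1 < size s)%N -> w \in s ->
  (forall v, v \in s -> Omega_ham p L (top_part v)) ->
  top_part w = 0 -> lbr s = 0.
Proof.
move=> s1 ws os w0.
case: s s1 ws os => // u s s0; rewrite inE => /orP[/eqP <-|ws] os.
  by rewrite lbr_cons_eq0 // w0 dR0.
case: s s0 os ws => // v s _ os ws; apply/funext => t; rewrite lbr_cons2.
have ou : Omega_ham p L (top_part u) by apply: os; rewrite inE eqxx.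
have aw := Omega_ham_alternating ou.
rewrite -cat_cons -map_cons; case/splitPr: ws => s1 s2.
rewrite map_cat -catA /=.
have hw : ham (top_part w) (ham_choice w).
  by apply: ham_choiceP; rewrite w0; exact: (Omega_ham_subspace subL).1.
have hw0 : ham (top_part w) 0 by rewrite w0; exact: ham0.
rewrite (ham_indep isoL _ _ aw (ham_choiceP ou) hw hw0).
have := (alternating_dR aw).1 (map ham_choice s1) (map ham_choice s2 ++ t) (-1) 0 0.
rewrite scaler0 addr0 mulN1r => /eqP; rewrite addNr => /eqP ->.
by rewrite scaler0.
Qed.

(** Exchanging the first two arguments is isotropy; exchanging later ones is
skew-symmetry of the differential of the first.  No Koszul sign enters, since the
bracket vanishes unless all degrees are [0]. *)
Lemma lbr_graded_skew : Defs.graded_skew V lbr.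
Proof.
move=> s1 s2 i j x y Vs Vx Vy.
have ox := Omega_ham_top_part Vx; have oy := Omega_ham_top_part Vy.
have os w : w \in s1 ++ x :: y :: s2 -> Omega_ham p L (top_part w).
  rewrite mem_cat !inE => /or4P[h|/eqP->|/eqP->|h] //.
    by have [|k /Omega_ham_top_part //] := Vs w; rewrite mem_cat h.
  by have [|k /Omega_ham_top_part //] := Vs w; rewrite mem_cat h orbT.
have os' w : w \in s1 ++ y :: x :: s2 -> Omega_ham p L (top_part w).
  by move=> h; apply: os; move: h; rewrite !mem_cat !inE [(w == y) || _]orbCA.
have sz u v : (1 < size (s1 ++ u :: v :: s2))%N by rewrite size_cat /=; lia.
have zero u : u \in [:: x; y] -> top_part u = 0 ->
    lbr (s1 ++ x :: y :: s2) = - ((-1) ^+ (`|i| * `|j|)%N *: lbr (s1 ++ y :: x :: s2)).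
  move=> h u0; have h1 : u \in s1 ++ x :: y :: s2.
    by move: h; rewrite mem_cat !inE => /orP[] ->; rewrite !orbT.
  have h2 : u \in s1 ++ y :: x :: s2.
    by move: h; rewrite mem_cat !inE => /orP[] ->; rewrite !orbT.
  by rewrite (lbr_top_eq0 _ h1) // (lbr_top_eq0 _ h2) // scaler0 oppr0.
have [i0|i0] := eqVneq i 0; last first.
  by apply: (zero x); rewrite ?inE ?eqxx // (top_part_neq0 i0).
have [j0|j0] := eqVneq j 0; last first.
  by apply: (zero y); rewrite ?inE ?eqxx ?orbT // (top_part_neq0 j0).
rewrite i0 j0 mul0n expr0 scale1r; apply/funext => t; rewrite cochainE.
case: s1 {zero sz Vs} os os' => [|u s1] os os'.
  rewrite !cat0s !lbr_cons2.
  by rewrite (ham_skew isoL _ (ham_choiceP oy) (ham_choiceP ox)) scalerN.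
have ou : Omega_ham p L (top_part u) by apply: os; rewrite inE eqxx.
rewrite !cat_cons !lbr_cat /= (alternating_dR (Omega_ham_alternating ou)).2.
by rewrite scalerN.
Qed.

Context (invL : dorfman_involutive p L).

Lemma Omega_cat k Ys w : Omega (size Ys + k) w ->
  Omega k (fun t : seq (vfield M) => w (Ys ++ t)).
Proof.
elim: Ys w => [|Y Ys IH] w //= Ow.
exact: IH (Omega_iota Y Ow).
Qed.

Lemma top_part_ham w : Omega_ham p L w -> top_part w = w.
Proof. by case=> h _; exact: top_part_Omega. Qed.

Lemma Omega_ham_top w : Omega_ham p L w -> Omega_ham p L (top_part w).
Proof. by move=> h; rewrite top_part_ham. Qed.

Lemma ham_choice_ham w : Omega_ham p L w -> ham w (ham_choice w).
Proof. by move=> h; have := ham_choiceP (Omega_ham_top h); rewrite top_part_ham. Qed.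

Lemma Omega_dR_ham w : Omega_ham p L w -> Omega p (dR w).
Proof. by case=> h _; have := Omega_dR h; rewrite prednK. Qed.

Lemma lbr2E v u : Omega_ham p L v ->
  lbr [:: v; u] = - iota (ham_choice u) (dR v).
Proof.
move=> hv; apply/funext => t; rewrite lbr_cons2 top_part_ham // cochainE.
by rewrite [eps _ _]sqrrN expr1n scaleN1r.
Qed.

Lemma ham_lbr2 v u : Omega_ham p L v -> Omega_ham p L u ->
  ham (lbr [:: v; u]) (vf_bracket (ham_choice v) (ham_choice u)).
Proof.
move=> hv hu; rewrite lbr2E //.
have := ham_bracket invL (Omega_ham_alternating hu) (Omega_ham_alternating hv)
  (ham_choice_ham hu) (ham_choice_ham hv).
move=> /(ham_scaleD subL (-1)) /(_ (ham0 subL)); rewrite !addr0 scaleN1r.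
rewrite [vf_bracket (ham_choice v) _]vf_bracketC.
by rewrite (_ : sf_cst M (-1) = -1) ?scaleN1r //; apply: val_inj.
Qed.

Lemma Omega_ham_lbr2 v u : Omega_ham p L v -> Omega_ham p L u ->
  Omega_ham p L (lbr [:: v; u]).
Proof.
move=> hv hu; split; last by eexists; exact: ham_lbr2.
rewrite lbr2E //; apply: OmegaN; apply: Omega_iota; rewrite prednK //.
exact: Omega_dR_ham.
Qed.

(** Two Hamiltonian forms have a Hamiltonian bracket by involutivity.  A bracket of
[k > 2] forms is a contraction of a [p]-form with [k - 1] fields: a form of degree
[p + 1 - k], which vanishes for [k > p + 1]. *)
Lemma lbr_degree0 s : (1 < size s)%N ->
  (forall w, w \in s -> Omega_ham p L w) -> V (2 - (size s)%:Z) (lbr s).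
Proof.
case: s => // v [//|u s] _ hs.
have hv : Omega_ham p L v by apply: hs; rewrite inE eqxx.
have hu : Omega_ham p L u by apply: hs; rewrite !inE eqxx orbT.
case: s hs => [|w s] hs.
  by rewrite ham_complex_deg0; exact: Omega_ham_lbr2.
have Ov := Omega_dR_ham hv.
rewrite /ham_complex; case: eqP => [/=|_]; first by lia.
case: ifPn => [h|h].
  apply: OmegaZ; rewrite top_part_ham //; apply: Omega_cat.
  rewrite size_map /=.
  suff -> : ((size s).+2 + absz (p%:Z - 1 + (2 - (size s).+3%:Z)%R)%R)%N = p.
    by [].
  by move: h => /=; lia.
apply/funext => t; rewrite lbr_cons2 top_part_ham // (Omega_support Ov) ?scaler0 //.
by rewrite /= size_cat size_map /=; move: h => /=; lia.
Qed.

(** The case split for homogeneous entries: the bracket vanishes in the first case,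
by [lbr_top_eq0]. *)
Lemma lbr_homogeneous s : (1 < size s)%N ->
  (forall w, w \in s -> homogeneous V w) ->
  (exists2 w, w \in s & top_part w = 0) \/ (forall w, w \in s -> Omega_ham p L w).
Proof.
move=> s1 hs; have [h|h] := pselect (exists2 w, w \in s & top_part w = 0).
  by left.
right=> w ws; have [i Vw] := hs w ws; have [i0|i0] := eqVneq i 0.
  by move: Vw; rewrite i0 ham_complex_deg0.
by exfalso; apply: h; exists w => //; exact: top_part_neq0 Vw.
Qed.

Lemma homogeneous_top s : (forall w, w \in s -> homogeneous V w) ->
  forall w, w \in s -> Omega_ham p L (top_part w).
Proof. by move=> hs w /hs[i /Omega_ham_top_part]. Qed.

Lemma lbr_large s : (p.+1 < size s)%N ->
  (forall w, w \in s -> homogeneous V w) -> lbr s = 0.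
Proof.
move=> sp hs; have s1 : (1 < size s)%N by lia.
have [[w ws w0]|h] := lbr_homogeneous s1 hs.
  exact: (lbr_top_eq0 s1 ws (homogeneous_top hs) w0).
have := lbr_degree0 s1 h; rewrite /ham_complex; case: eqP => [|_]; first by lia.
by case: ifP => //; lia.
Qed.

Lemma lbr1_degree i w : V i w -> V (i + 1) (lbr [:: w]).
Proof.
move=> Vw; rewrite (lbr1E Vw); case: eqP => [_|/eqP i0]; first exact: ham_complex0.
case: (ham_complexP Vw) => [[/eqP]|[lti ip Ow]|->]; first by rewrite (negPf i0).
  have Odw := Omega_dR Ow.
  rewrite /ham_complex; case: eqP => [i1|/eqP i1].
    split; last by exists 0; apply: ham_dR subL _ (Omega_alternating Ow).
    by rewrite (_ : p.-1 = (absz (p%:Z - 1 + i)).+1) //; lia.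
  rewrite ifT; last by lia.
  by rewrite (_ : absz (p%:Z - 1 + (i + 1)) = (absz (p%:Z - 1 + i)).+1) //; lia.
by rewrite dR0; exact: ham_complex0.
Qed.

Lemma lbr_has_degree : Defs.has_degree V lbr.
Proof.
move=> [//|[|k]] deg v _ Vv.
  rewrite big_ord1 enum_ordSl (_ : enum 'I_0 = [::]) /=; last first.
    by apply: size0nil; rewrite size_enum_ord.
  rewrite (_ : deg ord0 + 2 - 1%:Z = deg ord0 + 1); last by ring.
  exact: lbr1_degree.
set s := [seq v m | m <- _].
have sz : size s = k.+2 by rewrite size_map size_enum_ord.
have hs w : w \in s -> homogeneous V w.
  by move=> /mapP[m _ ->]; exists (deg m).
have s1 : (1 < size s)%N by rewrite sz.
have [/forallP d0|/forallPn[m dm]] := boolP [forall m, deg m == 0].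
  rewrite big1 => [|m _]; last exact/eqP.
  rewrite add0r -sz; apply: lbr_degree0 => // w /mapP[m _ ->].
  by have := Vv m; rewrite (eqP (d0 m)) ham_complex_deg0.
rewrite (@lbr_top_eq0 s (v m)) //; first exact: ham_complex0.
- by apply: map_f; rewrite mem_enum.
- exact: homogeneous_top.
- exact: top_part_neq0 (Vv m).
Qed.

Lemma cochain_sumE (I : Type) (r : seq I) (P : pred I) (F : I -> cochain M) t :
  (\sum_(i <- r | P i) F i) t = \sum_(i <- r | P i) F i t.
Proof. by rewrite fct_sumE. Qed.

Lemma sign_scale k f : (-1 : R) ^+ k *: f = (-1) ^+ k * f.
Proof.
rewrite -[in LHS]signr_odd -[in RHS]signr_odd.
by case: (odd k); rewrite /= ?expr1 ?expr0 ?scaleN1r ?mulN1r ?scale1r ?mul1r.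
Qed.

Lemma eps_double k : eps R k.*2 = (-1) ^+ k.+1.
Proof. by rewrite /eps odd_double doubleK. Qed.

Lemma eps_doubleS k : eps R k.*2.+1 = (-1) ^+ k.
Proof. by rewrite /eps /= odd_double doubleK. Qed.

(** This recursion is what matches the two kinds of surviving terms in the Jacobi
identity. *)
Lemma eps_succ k : eps R k.+1 = - (-1) ^+ k * eps R k.
Proof.
rewrite -signr_odd -(odd_double_half k).
case: (odd k); rewrite ?add1n ?add0n -?doubleS /= ?odd_double /=.
  by rewrite eps_double eps_doubleS !exprS; ring.
by rewrite eps_double eps_doubleS !exprS; ring.
Qed.

(** The terms of the Jacobi identity whose inner bracket contains the first
entry. *)
Lemma lbr_bracket_head v u ws t : Omega_ham p L v -> Omega_ham p L u ->
  (0 < size ws)%N ->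
  lbr (lbr [:: v; u] :: ws) t =
    eps R (size ws).+1 *: Lie (ham_choice u) (dR v) (map ham_choice ws ++ t).
Proof.
move=> hv hu s0; rewrite lbr_cons // top_part_ham; last exact: Omega_ham_lbr2.
rewrite lbr2E // dRN cochainE scalerN -scaleNr opprK; congr (_ *: _).
have av := Omega_ham_alternating hv.
have := iota_dR (ham_choice u) (alternating_dR av).2.
rewrite dR_dR // => /esym/eqP; rewrite subr_eq0 => /eqP -> //.
Qed.

(** The terms whose inner bracket does not contain the first entry [v]: isotropy
exchanges the inner bracket, with Hamiltonian field [[X_{u1}, X_{u2}]], with [v]. *)
Lemma lbr_bracket_tail v u1 u2 ws t : Omega_ham p L v ->
  Omega_ham p L u1 -> Omega_ham p L u2 ->
  lbr (lbr [:: u1; u2] :: v :: ws) t = eps R (size ws).+2 *: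
    dR v (vf_bracket (ham_choice u1) (ham_choice u2) :: map ham_choice ws ++ t).
Proof.
move=> hv h1 h2; rewrite lbr_cons2 top_part_ham; last exact: Omega_ham_lbr2.
rewrite (ham_skew isoL _ (ham_choice_ham hv) (ham_lbr2 h1 h2)).
by rewrite scalerN scaleNr opprK.
Qed.

(** The Jacobi identity on Hamiltonian forms.  With [w = d v], it is the equation
[d w = 0] written on the Hamiltonian fields of [r] by [dR_cat]. *)
Lemma lbr_jacobi_sum v r : (1 < size r)%N ->
  (forall w, w \in v :: r -> Omega_ham p L w) ->
  \sum_(a < (size r).+1) \sum_(b < size r | (a <= b)%N) (-1) ^+ (a + b) *:
    lbr (lbr [:: nth 0 (v :: r) a; nth 0 (delete_nth a (v :: r)) b]
           :: delete_nth b (delete_nth a (v :: r)))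
  + lbr [:: lbr (v :: r)] = 0.
Proof.
move=> r1 hs.
have hv : Omega_ham p L v by apply: hs; rewrite inE eqxx.
have hr b : (b < size r)%N -> Omega_ham p L r`_b.
  by move=> br; apply: hs; rewrite inE mem_nth ?orbT.
have av := Omega_ham_alternating hv.
have sz : size (v :: r) = (size r).+1 by [].
pose Y := map ham_choice r.
have sY : size Y = size r by rewrite size_map.
have r0 : (0 < size r)%N by exact: ltnW.
apply/funext => t; rewrite cochainE [RHS]/(0 : C).
have dd : dR (dR v) (Y ++ t) = 0 by rewrite dR_dR.
rewrite dR_cat in dd; last exact: alternating_dR.
have -> : lbr [:: lbr (v :: r)] t =
    - eps R (size r).+1 *: dR (fun x => dR v (Y ++ x)) t.
  have := lbr_degree0 (_ : (1 < size (v :: r))%N) hs.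
  move=> /(_ r0) /lbr1E ->; rewrite ifN; last by rewrite /=; lia.
  have -> : lbr (v :: r) = - eps R (size r).+1 *: (fun x => dR v (Y ++ x)).
    by apply/funext => x; rewrite lbr_cons // top_part_ham.
  by rewrite dRZ.
(* [dd] reads [S1 - S2 + (-1) ^+ size Y * D = 0]: the pairs containing [v], the other
   pairs, and the bracket of full length. *)
set D := dR (fun x => dR v (Y ++ x)) t in dd *.
set S1 := \sum_(_ < _) _ in dd; set S2 := \sum_(_ < _) _ in dd.
suff -> : (\sum_(a < (size r).+1) \sum_(b < size r | (a <= b)%N) (-1) ^+ (a + b) *:
    lbr (lbr [:: nth 0 (v :: r) a; nth 0 (delete_nth a (v :: r)) b]
           :: delete_nth b (delete_nth a (v :: r)))) t = eps R (size r) *: (S1 - S2).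
  move/eqP: dd; rewrite addr_eq0 sY => /eqP ->.
  by rewrite eps_succ mulNr opprK -sign_scale scalerN scalerA mulrC addNr.
rewrite cochain_sumE big_ord_recl scalerDr; congr (_ + _).
  rewrite cochain_sumE /S1 sY scaler_sumr; apply: eq_bigr => b _.
  have sb : size (delete_nth b r) = (size r).-1 by rewrite size_delete_nth.
  have hb := hr b (ltn_ord b).
  rewrite delete_nth0 cochainE lbr_bracket_head // sb; last by lia.
  rewrite prednK // (nth_map 0) // map_delete_nth scalerA mulrC -scalerA.
  by rewrite (sign_scale b).
rewrite /S2 sY scalerN scaler_sumr -sumrN.
have -> : \sum_(j < size r) - (eps R (size r) *: \sum_(i < j) (-1) ^+ (i + j) *
      dR v (vf_bracket Y`_i Y`_j :: delete_nth i (delete_nth j Y) ++ t)) =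
    \sum_(j < size r) \sum_(i < size r | (i < j)%N) eps R (size r) *:
      ((-1) ^+ (i + j).+1 *
      dR v (vf_bracket Y`_i Y`_j :: delete_nth i (delete_nth j Y) ++ t)).
  apply: eq_bigr => j _.
  rewrite -(big_ord_widen (size r) (fun m => eps R (size r) *: ((-1) ^+ (m + j).+1 *
      dR v (vf_bracket Y`_m Y`_j :: delete_nth m (delete_nth j Y) ++ t))));
    last exact: ltnW.
  rewrite scaler_sumr -sumrN; apply: eq_bigr => i _.
  by rewrite exprS mulN1r mulNr scalerN.
(* [b.+1] is the position in [v :: r] without its entry [m.+1]; as [m <= b], this is the
   entry [b.+1] of [r]. *)
have tail_term m b : (m <= b)%N -> (b.+1 < size r)%N ->
    lbr (lbr [:: nth 0 (v :: r) m.+1; nth 0 (delete_nth m.+1 (v :: r)) b.+1]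
      :: delete_nth b.+1 (delete_nth m.+1 (v :: r))) t =
    eps R (size r) *:
      dR v (vf_bracket Y`_m Y`_b.+1 :: delete_nth m (delete_nth b.+1 Y) ++ t).
  move=> mb br; have mr : (m < size r)%N by lia.
  rewrite -[delete_nth m.+1 (v :: r)]/(v :: delete_nth m r).
  rewrite -[delete_nth b.+1 (v :: _)]/(v :: delete_nth b (delete_nth m r)).
  rewrite -[nth 0 (v :: r) m.+1]/(nth 0 r m).
  rewrite -[nth 0 (v :: _) b.+1]/(nth 0 (delete_nth m r) b).
  rewrite nth_delete_nth // delete_nthC //.
  have hm := hr m mr; have hb := hr b.+1 br.
  rewrite lbr_bracket_tail // !size_delete_nth //; last by lia.
  rewrite !(nth_map 0) // !map_delete_nth; congr (eps R _ *: _).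
  by lia.
rewrite (exchange_big_dep predT) //; apply: eq_bigr => m _.
rewrite cochain_sumE; apply: eq_bigr => [[[|b] br]] // mb.
rewrite cochainE [lbr _ _](tail_term m b) // scalerA mulrC -scalerA.
by rewrite (sign_scale (m + b.+1).+1).
Qed.

Lemma lbr_lbr1 i w : V i w -> lbr [:: lbr [:: w]] = 0.
Proof.
move=> Vw; rewrite (lbr1E (lbr1_degree Vw)); case: ifP => // _.
rewrite (lbr1E Vw); case: ifP => _; first exact: dR0.
exact: dR_dR (ham_complex_alternating Vw).
Qed.

(** The unary bracket of an entry is zero or an exact form, and the differential of
an exact form vanishes. *)
Lemma lbr_lbr1_cons s : (1 < size s)%N ->
  (forall w, w \in s -> homogeneous V w) ->
  lbr (lbr (take 1 s) :: drop 1 s) = 0.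
Proof.
case: s => [|w [|u s]] // _ hs.
rewrite -[take 1 _]/[:: w] -[drop 1 _]/(u :: s).
have [i Vw] : homogeneous V w by apply: hs; rewrite inE eqxx.
apply: lbr_cons_eq0 => //.
have V1 := lbr1_degree Vw; have [i0|i0] := eqVneq (i + 1) 0; last first.
  by rewrite (top_part_neq0 i0 V1) dR0.
rewrite top_part_ham; last by rewrite -ham_complex_deg0 -i0.
rewrite (lbr1E Vw); case: ifP => _; first exact: dR0.
exact: dR_dR (ham_complex_alternating Vw).
Qed.

Lemma homogeneous_lbr s : (1 < size s)%N ->
  (forall w, w \in s -> homogeneous V w) -> homogeneous V (lbr s).
Proof.
move=> s1 hs; have [[w ws w0]|h] := lbr_homogeneous s1 hs.
  rewrite (lbr_top_eq0 s1 ws (homogeneous_top hs) w0).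
  by exists 0; exact: ham_complex0.
by exists (2 - (size s)%:Z); exact: lbr_degree0.
Qed.

(** The entry [w] annihilates the inner bracket or the outer one. *)
Lemma lbr_lbr_top_eq0 s w k : (1 < k <= size s)%N ->
  (forall u, u \in s -> homogeneous V u) -> w \in s -> top_part w = 0 ->
  lbr (lbr (take k s) :: drop k s) = 0.
Proof.
move=> /andP[k1 ks] hs ws w0.
have st : (1 < size (take k s))%N by rewrite size_takel.
have ht u : u \in take k s -> homogeneous V u by move=> h; apply/hs/mem_take/h.
have hd u : u \in drop k s -> homogeneous V u by move=> h; apply/hs/mem_drop/h.
move: ws; rewrite -{1}(cat_take_drop k s) mem_cat => /orP[wt|wd].
  by rewrite (lbr_top_eq0 st wt (homogeneous_top ht) w0) lbr_0.
apply: (@lbr_top_eq0 _ w) => //; last 2 first.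
- by rewrite inE wd orbT.
- move=> u; rewrite inE => /orP[/eqP ->|]; last exact: (homogeneous_top hd).
  by have [i /Omega_ham_top_part] := homogeneous_lbr st ht.
by rewrite /= ltnS; case: (drop k s) wd.
Qed.

(** The inner bracket has negative degree. *)
Lemma lbr_lbr_degree0 s k : (2 < k < size s)%N ->
  (forall w, w \in s -> Omega_ham p L w) ->
  lbr (lbr (take k s) :: drop k s) = 0.
Proof.
move=> /andP[k2 ks] hs; apply: lbr_cons_eq0; last by rewrite size_drop subn_gt0.
have st : size (take k s) = k by rewrite size_takel // ltnW.
have /lbr_degree0 : (1 < size (take k s))%N by rewrite st ltnW.
move=> /(_ (fun w h => hs w (mem_take h))) /top_part_neq0 ->; first exact: dR0.
by rewrite st; lia.
Qed.

(** Entries that are not all of degree [0] annihilate every summand.  For Hamiltonian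
forms only the inner brackets of length two and of full length survive, and these
two are [lbr_jacobi_sum]. *)
Lemma lbr_jacobi_identities : Defs.jacobi_identities V lbr.
Proof.
move=> [//|k] deg v _ Vv.
have hv (s : 'S_k.+1) w : w \in [seq v (s m) | m <- enum 'I_k.+1] ->
    homogeneous V w.
  by move=> /mapP[m _ ->]; exists (deg (s m)).
have sv (s : 'S_k.+1) : size [seq v (s m) | m <- enum 'I_k.+1] = k.+1.
  by rewrite size_map size_enum_ord.
case: k deg v Vv hv sv => [|k] deg v Vv hv sv.
  rewrite big_nat1 big1 // => s _; cbv zeta.
  have -> : enum 'I_1 = [:: ord0] by rewrite enum_ordSl enum_ord0.
  rewrite -[lbr _]/(lbr [:: lbr [:: v (s ord0)]]).
  by rewrite (lbr_lbr1 (Vv _)) scaler0.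
have lbr1_0 (s : 'S_k.+2) : lbr (lbr (take 1 [seq v (s m) | m <- enum 'I_k.+2])
    :: drop 1 [seq v (s m) | m <- enum 'I_k.+2]) = 0.
  by apply: lbr_lbr1_cons; rewrite ?sv //; exact: hv.
have [/forallP d0|/forallPn[m dm]] := boolP [forall m, deg m == 0]; last first.
  rewrite big_nat big1 // => j /andP[j1 jk]; rewrite big1 // => s _; cbv zeta.
  have [->|jn1] := eqVneq j 1%N; first by rewrite lbr1_0 scaler0.
  rewrite (@lbr_lbr_top_eq0 _ (v m)) ?scaler0 // ?sv; first by lia.
  - exact: hv.
  - by rewrite -[m](permKV s); apply: map_f; rewrite mem_enum.
  - exact: top_part_neq0 (Vv m).
have {d0} degE : deg = fun=> 0 by apply/funext => m; apply/eqP.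
subst deg.
have hV (s : 'S_k.+2) w : w \in [seq v (s m) | m <- enum 'I_k.+2] ->
    Omega_ham p L w.
  by move=> /mapP[m _ ->]; rewrite -ham_complex_deg0; exact: Vv.
(* The summand of index one, which has inner brackets of length one, vanishes. *)
rewrite big_ltn // [X in X + _]big1 ?add0r; last first.
  by move=> s _; cbv zeta; rewrite lbr1_0 scaler0.
pose vs := [seq v m | m <- enum 'I_k.+2].
have vsE : vs = [seq v m | m <- enum 'I_k.+2] by [].
have top_term : \sum_(s : 'S_k.+2 | unshuffle k.+2 s)
    (chi (fun=> 0) s * (-1) ^+ (k.+2 * (k.+2 - k.+2))) *:
    lbr (lbr (take k.+2 [seq v (s m) | m <- enum 'I_k.+2])
      :: drop k.+2 [seq v (s m) | m <- enum 'I_k.+2]) = lbr [:: lbr vs].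
  rewrite (eq_bigl (pred1 1%g)) => [|s]; last first.
    by rewrite unshuffle_trivial ?eqxx ?orbT.
  rewrite big_pred1_eq chi_degree0 odd_perm1 subnn muln0 !expr0 mulr1 scale1r.
  rewrite take_oversize ?drop_oversize ?sv //.
  by congr (lbr [:: lbr _]); apply: eq_map => m; rewrite perm1.
have sz : size vs = k.+2 by rewrite size_map size_enum_ord.
have hvs w : w \in vs -> Omega_ham p L w.
  by move=> /mapP[m _ ->]; rewrite -ham_complex_deg0; exact: Vv.
rewrite big_nat_recr // -[LHS]/(\sum_(2 <= i < k.+2) _ + _).
rewrite [X in _ + X]top_term.
case: k v Vv hv sv lbr1_0 hV vs vsE top_term sz hvs =>
    [|k] v Vv hv sv lbr1_0 hV vs vsE top_term sz hvs.
  (* With two entries the inner bracket of full length is the one of length two. *)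
  rewrite big_geq // add0r (@lbr1E 0) //.
  by have := lbr_degree0 _ hvs; rewrite sz; apply.
rewrite big_ltn // [X in _ + X + _](_ : _ = 0) ?addr0; last first.
  rewrite big_nat big1 // => j /andP[j2 jk]; rewrite big1 // => s _; cbv zeta.
  rewrite (@lbr_lbr_degree0 _ j) ?scaler0 ?sv ?j2 //.
  exact: hV.
pose G x := lbr (lbr (take 2 x) :: drop 2 x).
rewrite (eq_bigr (fun s : 'S_k.+3 =>
    (-1) ^+ s *: G [seq v (s m) | m <- enum 'I_k.+3])); last first.
  move=> s _; rewrite chi_degree0 -[X in _ * X]signr_odd oddM /= expr0 mulr1.
  by [].
have GE x y z : G [:: x, y & z] = lbr (lbr [:: x; y] :: z).
  have take2 : take 2 [:: x, y & z] = [:: x; y] by rewrite /= take0.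
  have drop2 : drop 2 [:: x, y & z] = z by rewrite /= drop0.
  by rewrite /G take2 drop2.
rewrite (sum_unshuffle2_seq G vsE).
under eq_bigr do under eq_bigr do rewrite GE.
clear top_term vsE; case: vs sz hvs => // u r [sr] hr.
have := lbr_jacobi_sum (_ : (1 < size r)%N) hr; rewrite sr => /(_ isT).
exact.
Qed.

Lemma lbr_Linfty : Linfty_algebra V lbr.
Proof.
split; [exact: ham_complex_subspace | exact: ham_complex_independent |].
split; [exact: lbr_multilinear | exact: lbr_has_degree | exact: lbr_graded_skew |].
exact: lbr_jacobi_identities.
Qed.

(** Isotropy exchanges the roles of the first two forms, and the chosen fields may be
replaced by arbitrary Hamiltonian fields. *)
Lemma lbr_explicit k (a : 'I_k.+2 -> cochain M) (X : 'I_k.+2 -> vfield M) :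
  (forall m, Omega_ham p L (a m)) -> (forall m, ham (a m) (X m)) ->
  lbr [seq a m | m <- enum 'I_k.+2] = eps R k.+2 *:
    foldl (fun w Y => interior_product Y w)
      (interior_product (X ord0) (dR (a (inord 1))))
      (drop 2 [seq X m | m <- enum 'I_k.+2]).
Proof.
move=> ha hX; apply/funext => t.
have foldE (Ys : seq (vfield M)) w :
    foldl (fun w Y => interior_product Y w) w Ys t = w (Ys ++ t).
  by elim: Ys w => //= Y Ys IH w; rewrite IH.
have -> : inord 1 = lift ord0 ord0 :> 'I_k.+2.
  by apply: val_inj; rewrite /= inordK.
have [r enumE] : exists r, enum 'I_k.+2 = [:: ord0, lift ord0 ord0 & r].
  by eexists; rewrite !enum_ordSl.
have dropE : drop 2 [seq X m | m <- enum 'I_k.+2] = map X r.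
  by rewrite enumE /= drop0.
rewrite cochainE foldE dropE enumE !map_cons lbr_cons2 top_part_ham // size_map.
have -> : size r = k by have := size_enum_ord k.+2; rewrite enumE => -[].
rewrite (ham_skew isoL _ (ham_choice_ham (ha (lift ord0 ord0))) (hX ord0)).
rewrite scalerN scaleNr opprK /interior_product -map_comp; congr (_ *: _).
apply: (ham_indep_map isoL r [:: X ord0] t _ (hX (lift ord0 ord0))).
  exact: Omega_ham_alternating.
by move=> m; exists (a m); split; [exact: ham_choice_ham | exact: hX].
Qed.

End Brackets.

Theorem theorem6p7 (R : realType) (n : nat) (M : manifold R n) (p : nat)
    (p_ge1 : (1 <= p)%N) (L : forall x : M, set (bundle_fiber x))
    (subL : subbundle p L) (isoL : isotropic L) (invL : dorfman_involutive p L) :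
  exists l : seq (cochain M) -> cochain M,
    [/\ Lie_p_algebra p (ham_complex p L) l,
        forall (i : int) (w : cochain M), i < 0 -> ham_complex p L i w ->
          l [:: w] = dR w,
        forall w : cochain M, ham_complex p L 0 w -> l [:: w] = 0,
        forall (k : nat) (a : 'I_k.+2 -> cochain M) (X : 'I_k.+2 -> vfield M),
          (k.+2 <= p.+1)%N ->
          (forall i, Omega_ham p L (a i)) ->
          (forall i, ham_vfield p L (a i) (X i)) ->
          l [seq a i | i <- enum 'I_k.+2] =
            eps R k.+2 *:
              foldl (fun w Y => interior_product Y w)
                (interior_product (X ord0) (dR (a (inord 1))))
                (drop 2 [seq X i | i <- enum 'I_k.+2])
      & forall s : seq (cochain M), (2 <= size s)%N ->
          (forall w, w \in s -> homogeneous (ham_complex p L) w) ->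
          (p.+1 < size s)%N \/
            (exists2 w, w \in s & exists2 i : int, i < 0 & ham_complex p L i w) ->
          l s = 0].
Proof.
exists (lbr p L); split.
- split; first exact: lbr_Linfty.
  move=> i hi; rewrite /ham_complex; case: eqP => [i0|_].
    by move: hi; rewrite i0; lia.
  by case: ifP => //; move: hi; lia.
- by move=> i w i0 Vw; rewrite (lbr1E p_ge1 Vw) (lt_eqF i0).
- by move=> w Vw; rewrite (lbr1E p_ge1 Vw) eqxx.
- by move=> k a X _ ha hX; exact: lbr_explicit.
- move=> s s1 hs [sp|[w ws [i i0 Vw]]]; first exact: lbr_large.
  apply: (lbr_top_eq0 _ _ s1 ws) => //; first exact: homogeneous_top.
  by apply: (top_part_neq0 p_ge1 _ Vw); rewrite (lt_eqF i0).
Qed.
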